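(* Let $\mathcal T$ be a set of tile designs for the regular icosahedron with symmetry group the full icosahedral group $I_h$ (order $120$). Suppose there are $t_{\mathrm{id}}$ tiles, of which $t_r$ are fixed under $120^\circ$ rotation and $t_f$ are fixed under (horizontal) reflection of the equilateral triangular face. Then the number of ways of tiling the faces of the icosahedron up to full icosahedral symmetry $I_h$ is $$\frac{1}{120}\left(t_{\mathrm{id}}^{20}+24t_{\mathrm{id}}^4+20t_{\mathrm{id}}^6t_r^2+15t_{\mathrm{id}}^{10}+t_{\mathrm{id}}^{10}+24t_{\mathrm{id}}^2+20t_{\mathrm{id}}^3t_r+15t_{\mathrm{id}}^8t_f^4\right).$$
   Context: Tilings. Let $P$ be a polyhedron with set of faces $\mathcal F$ and let $\mathcal A$ be a group of isometries of $P$, acting on $\mathcal F$. A set of tile designs is a finite set $\mathcal T$ together with a group action of $\mathcal A$ on $\mathcal T\times\mathcal F$ lying over the action on $\mathcal F$ (so $A\cdot(T,F)=(T',A\cdot F)$ for some $T'\in\mathcal T$). A tiling is a map $\tau:\mathcal F\to\mathcal T$; $\mathcal A$ acts on tilings by moving graphs: $A\cdot\tau$ is the tiling with $((A\cdot\tau)(A\cdot F),A\cdot F)=A\cdot(\tau(F),F)$ for all $F$. The number of ways of tiling up to $\mathcal A$ is the number of $\mathcal A$-orbits on the set of tilings. The induced symmetry group $G$ of a face $F$ is the group of isometries of $F$ realized by elements of the stabilizer $\mathcal A_F$; for $g\in G$, $t_g$ is the number of $T\in\mathcal T$ with $g\cdot(T,F)=(T,F)$, where $g$ acts via the element of $\mathcal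 A_F$ inducing it. Since $\mathcal A$ acts transitively on faces, $t_g$ does not depend on the choice of $F$. In particular $t_{\mathrm{id}}=|\mathcal T|$. Polyhedron and group. Let $\phi=(1+\sqrt5)/2$. Here $\mathcal A=I_h$ is the group of order $120$ generated by $R_0=\mathrm{diag}(-1,1,1)$, $R_2=\mathrm{diag}(1,-1,1)$ and $R_1=\frac12\begin{pmatrix}1-\phi&-\phi&-1\\-\phi&1&1-\phi\\-1&1-\phi&\phi\end{pmatrix}$. The icosahedron is the convex hull of the $I_h$-orbit of $(0,1,\phi)$ ($12$ vertices, $20$ equilateral triangular faces). The induced symmetry group of a face is $D_3=\langle r,f\mid r^3=f^2=(rf)^2=e\rangle$, with $r$ a $120^\circ$ rotation and $f$ a reflection of the triangle. *)

(* Defs.v *)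
From HB Require Import structures.
From mathcomp Require Import all_boot all_order all_algebra.
From mathcomp Require Import all_classical all_reals all_analysis.

Set Implicit Arguments.
Unset Strict Implicit.
Unset Printing Implicit Defensive.

Import Order.TTheory GRing.Theory Num.Theory.
Local Open Scope classical_set_scope.
Local Open Scope ring_scope.

Section Geometry.
Variable R : realType.
Local Notation V := 'cV[R]_3.
Implicit Types (P F : set V) (G : set 'M[R]_3).

Definition matrix_group G : Prop :=
  [/\ G 1%:M,
      forall a b, G a -> G b -> G (a *m b) &
      forall a, G a -> a \in unitmx /\ G (invmx a)].

Definition generated_group (S : set 'M[R]_3) : set 'M[R]_3 :=
  smallest matrix_group S.

Definition convex_hull (S : set V) : set V := smallest (@convex_set R V) S.

(* The intersection of P with a supporting plane [n x = b], required to contain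
   three affinely independent points and hence to have dimension exactly 2. *)
Definition is_face P F : Prop :=
  (exists (n : 'rV[R]_3) (b : R),
     [/\ n != 0,
         forall x, P x -> (n *m x) 0 0 <= b &
         F = [set x | P x /\ (n *m x) 0 0 = b]])
  /\ (exists p q r, [/\ F p, F q, F r &
        \rank (row_mx (q - p) (r - p)) = 2%N]).

Definition faces P : set (set V) := [set F | is_face P F].

Definition dot (u v : V) : R := (u^T *m v) 0 0.

Definition planar_frame F (o u v : V) : Prop :=
  [/\ dot u u = 1, dot v v = 1, dot u v = 0 &
      forall x, F x -> exists s t : R, x = o + s *: u + t *: v].

(* The frame may have either orientation, so that this covers the rotations by
   [theta] and by [- theta]. *)
Definition is_rotation (theta : R) F (g : V -> V) : Prop :=
  exists o u v, planar_frame F o u v /\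
    forall s t : R, F (o + s *: u + t *: v) ->
      g (o + s *: u + t *: v) =
        o + (cos theta * s - sin theta * t) *: u
          + (sin theta * s + cos theta * t) *: v.

Definition is_reflection F (g : V -> V) : Prop :=
  exists o u v, planar_frame F o u v /\
    forall s t : R, F (o + s *: u + t *: v) ->
      g (o + s *: u + t *: v) = o + s *: u - t *: v.

End Geometry.

Section Tilings.
Variables (R : realType) (G : set 'M[R]_3) (P : set 'cV[R]_3) (T : finType).

(* An action of G on T * faces P lying over the action of G on faces.  The
   function [td_act] is total, but only its values on members of G matter. *)
Record tile_designs := TileDesigns {
  td_act :> 'M[R]_3 -> T * faces P -> T * faces P;
  td_act1 : forall x, td_act 1%:M x = x;
  td_actM : forall a b x, G a -> G b ->
    td_act (a *m b) x = td_act a (td_act b x);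
  td_over : forall a t (F : faces P), G a ->
    val (td_act a (t, F)).2 = mulmx a @` val F }.

Definition tiling := faces P -> T.

(* [moves D a tau tau'] states that tau' = a . tau. *)
Definition moves (D : tile_designs) (a : 'M[R]_3) (tau tau' : tiling) : Prop :=
  forall F F' : faces P, val F' = mulmx a @` val F ->
    (tau' F', F') = D a (tau F, F).

Definition tiling_orbit (D : tile_designs) (tau : tiling) : set tiling :=
  [set tau' | exists2 a, G a & moves D a tau tau'].

Definition tiling_orbits (D : tile_designs) : set (set tiling) :=
  range (tiling_orbit D).

Definition face_stabilizer (F : faces P) : set 'M[R]_3 :=
  [set a | G a /\ mulmx a @` val F = val F].

Definition fixed_tiles (D : tile_designs) (a : 'M[R]_3) (F : faces P) : nat :=
  #|[pred t : T | D a (t, F) == (t, F)]|.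

End Tilings.

Section Icosahedron.
Variable R : realType.

Definition phi : R := (1 + Num.sqrt 5) / 2.

Definition mx_of_rows (s : seq (seq R)) : 'M[R]_3 :=
  \matrix_(i, j) (nth [::] s i)`_j.

Definition R0 : 'M[R]_3 :=
  mx_of_rows [:: [:: -1; 0; 0];
                 [::  0; 1; 0];
                 [::  0; 0; 1]].

Definition R1 : 'M[R]_3 := 2^-1 *:
  mx_of_rows [:: [:: 1 - phi;   - phi;      - 1];
                 [::   - phi;       1;  1 - phi];
                 [::     - 1; 1 - phi;      phi]].

Definition R2 : 'M[R]_3 :=
  mx_of_rows [:: [:: 1;  0; 0];
                 [:: 0; -1; 0];
                 [:: 0;  0; 1]].

Definition Ih : set 'M[R]_3 := generated_group [set R0; R1; R2].

Definition base_vertex : 'cV[R]_3 := \col_(i < 3) [:: 0; 1; phi]`_i.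

Definition icosahedron : set 'cV[R]_3 :=
  convex_hull [set a *m base_vertex | a in Ih].

End Icosahedron.

Arguments Ih R : clear implicits.
Arguments icosahedron R : clear implicits.

(* Main.v *)
From mathcomp Require Import all_boot all_order all_algebra all_fingroup.
From mathcomp Require Import all_classical all_reals all_analysis.
From mathcomp Require Import ring lra.
Require Import Defs.
Set Implicit Arguments.
Unset Strict Implicit.
Unset Printing Implicit Defensive.
Import Order.TTheory GRing.Theory Num.Theory.
Local Open Scope classical_set_scope.
Local Open Scope ring_scope.

(** The orbits are counted by the Cauchy-Frobenius formula, with the group
acting on the faces.

All the geometry takes place over the ring Z[phi].  The faces of the
icosahedron are in bijection with the 20 triangles of pairwise adjacent
vertices: a supporting plane whose contact set is two-dimensional touches three
vertices, and two vertices v and w in the same supporting plane are adjacent,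
since otherwise either w = - v or phi (v + w) is the sum of two vertices, one of
which would have to lie beyond the plane
([supporting_adjacent], [face_classification]).  The generators permute the
20 face normals, which span the space, so that the group is faithfully a group
of permutations of 20 letters; closing up the generators gives 120 permutations,
which are exactly those that the group induces ([Ih_code], [codes_realised]).

A tiling is fixed by a symmetry s when it is equivariant along the cycles of s on
the faces.  On a cycle of length l the tile on one face k determines the others,
and it may be any tile that is fixed by the holonomy s ^ l, which is an element
of the stabiliser of k ([card_equivariant]).  This holonomy is trivial, of order
3 or a reflection of k, and accordingly there are t_id, t_r or t_f choices: any
two pairs (element, fixed face) with elements of the same order 2 or 3 are
conjugate, so that the numbers do not depend on the face ([card_fixed_order]).
A given rotation by 120 degrees of a face has order 3 and a given reflection has
order 2 ([rotation_cube], [reflection_square]), whence these are the classes to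
which t_r and t_f belong.  It remains to tabulate, for each of the 120
permutations, the orders of the holonomies of its cycles; the tally
([holonomy_tally]) gives the eight terms of the formula, one for each type of
isometry: the identity, the rotations by multiples of 72 degrees, by 120
degrees and by 180 degrees, and the products of these with -1. *)

(** * Arithmetic in the ring of golden integers *)

(** The pair (a, b) stands for a + b phi; [zmul] uses phi ^ 2 = phi + 1. *)
Definition zphi := (int * int)%type.
Definition zadd (x y : zphi) : zphi := (x.1 + y.1, x.2 + y.2).
Definition zmul (x y : zphi) : zphi :=
  (x.1 * y.1 + x.2 * y.2, x.1 * y.2 + x.2 * y.1 + x.2 * y.2).
Definition zvec (g : nat -> zphi) : seq zphi := [:: g 0%N; g 1%N; g 2%N].
Definition zcoord (u : seq zphi) (i : nat) : zphi := nth (0, 0) u i.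
Definition zdot (u v : seq zphi) : zphi :=
  zadd (zadd (zmul (zcoord u 0) (zcoord v 0)) (zmul (zcoord u 1) (zcoord v 1)))
       (zmul (zcoord u 2) (zcoord v 2)).
Definition zvadd (u v : seq zphi) := zvec (fun i => zadd (zcoord u i) (zcoord v i)).
Definition zscale (c : zphi) (u : seq zphi) := zvec (fun i => zmul c (zcoord u i)).
Definition zapply (A : seq (seq zphi)) (u : seq zphi) :=
  zvec (fun i => zdot (nth [::] A i) u).

(** * Vertices, triangles and generators in coordinates *)

(** Twice the matrices of the three generating reflections, to stay integral. *)
Definition zgens : seq (seq (seq zphi)) :=
  [:: [:: [:: (- 2%:Z, 0); (0, 0); (0, 0)];
          [:: (0, 0); (2%:Z, 0); (0, 0)];
          [:: (0, 0); (0, 0); (2%:Z, 0)]];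
      [:: [:: (1, -1); (0, -1); (-1, 0)];
          [:: (0, -1); (1, 0); (1, -1)];
          [:: (-1, 0); (1, -1); (0, 1)]];
      [:: [:: (2%:Z, 0); (0, 0); (0, 0)];
          [:: (0, 0); (- 2%:Z, 0); (0, 0)];
          [:: (0, 0); (0, 0); (2%:Z, 0)]]].

Definition zcross (u v : seq zphi) : seq zphi :=
  let minor i j := zadd (zmul (zcoord u i) (zcoord v j))
                        (zmul (-1, 0) (zmul (zcoord u j) (zcoord v i))) in
  [:: minor 1 2; minor 2 0; minor 0 1]%N.

(** The field norm of Q(sqrt 5): that it is nonzero is an integer computation,
and it shows that a real number a + b phi is nonzero. *)
Definition znorm (x : zphi) : int := x.1 ^+ 2 + x.1 * x.2 - x.2 ^+ 2.
Definition zdet (u v w : seq zphi) := zdot u (zcross v w).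

(** Cramer's rule: this is det(u, v, w) times x, written as a combination of
u, v and w. *)
Definition zcramer (u v w x : seq zphi) : seq zphi :=
  zvadd (zvadd (zscale (zdot x (zcross v w)) u) (zscale (zdot x (zcross w u)) v))
        (zscale (zdot x (zcross u v)) w).

Definition zvertices : seq (seq zphi) :=
  [:: [:: (0, 0); (1, 0); (0, 1)];   [:: (1, 0); (0, 1); (0, 0)];
      [:: (0, 1); (0, 0); (1, 0)];   [:: (0, 0); (-1, 0); (0, 1)];
      [:: (-1, 0); (0, 1); (0, 0)];  [:: (0, -1); (0, 0); (1, 0)];
      [:: (0, 0); (1, 0); (0, -1)];  [:: (1, 0); (0, -1); (0, 0)];
      [:: (0, 1); (0, 0); (-1, 0)];  [:: (0, 0); (-1, 0); (0, -1)];
      [:: (-1, 0); (0, -1); (0, 0)]; [:: (0, -1); (0, 0); (-1, 0)]].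
Definition zvertex i := nth [::] zvertices i.

(** The inner product of two vertices is phi + 2, phi, - phi or - phi - 2, and it
is phi exactly for the two ends of an edge. *)
Definition adjacent i j := zdot (zvertex i) (zvertex j) == (0, 1).

Definition triangles : seq (seq nat) := Eval vm_compute in
  [seq t <- [seq [:: i; p.1; p.2] | i <- iota 0 12,
                                    p <- [seq (j, k) | j <- iota 0 12, k <- iota 0 12]] |
    sorted ltn t && pairwise adjacent t].
Definition corner k i := nth 0%N (nth [::] triangles k) i.

(** Outer normals, as sums of three vertices; the empty sequence is the zero
vector here because missing coordinates are read as 0. *)
Definition znormals : seq (seq zphi) := Eval vm_compute in
  [seq foldr zvadd [::] (map zvertex t) | t <- triangles].
Definition znormal k := nth [::] znormals k.

(** The inner product of a face normal with the corners of that face. *)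
Definition face_value : zphi := (2%:Z, 3%:Z).

Definition double : seq zphi -> seq zphi := zscale (2%:Z, 0).

(** The permutation c of the numbers below 20 is coded by the sequence of its
values, c_k being the image of the face k. *)
Definition face_gens : seq (seq nat) := Eval vm_compute in
  [seq [seq index (zapply A u) (map double znormals) | u <- znormals] | A <- zgens].
Definition vertex_gens : seq (seq nat) := Eval vm_compute in
  [seq [seq index (zapply A u) (map double zvertices) | u <- zvertices] | A <- zgens].

(** * The group as a list of 120 permutations *)

Fixpoint closure (S T : eqType) (step : S -> T -> T) (gens : seq S) (x : T) (n : nat) :=
  if n is n'.+1 then
    let L := closure step gens x n' in undup (L ++ [seq step g y | g <- gens, y <- L])
  else [:: x].

Definition code_id : seq nat := iota 0 20.
Definition code_comp (c d : seq nat) : seq nat := [seq nth 0%N c x | x <- d].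

(** Every element of H3 is a product of at most 15 generating reflections. *)
Definition codes : seq (seq nat) := Eval vm_compute in closure code_comp face_gens code_id 15.

Definition code_pow c n := iter n (code_comp c) code_id.

(** The group has no element of order above 10; the value 11 would mean that no
power up to the tenth is the identity. *)
Definition code_order c := (index code_id [seq code_pow c n.+1 | n <- iota 0 10]).+1.
Definition stab_pairs n : seq (seq nat * nat) :=
  [seq p <- [seq (c, k) | c <- [seq c <- codes | code_order c == n], k <- code_id] |
    nth 0%N p.1 p.2 == p.2].
Definition conjugate (p q : seq nat * nat) :=
  has (fun d => (nth 0%N d p.2 == q.2) && (code_comp d p.1 == code_comp q.1 d)) codes.

(** The least face in the cycle of k serves as the base of the cycle; the
position of k is counted from there. *)
Definition cycle_root c k := foldr minn k (traject (nth 0%N c) k 20).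
Definition cycle_pos c k := index k (traject (nth 0%N c) (cycle_root c k) 20).
Definition cycle_len c k := (index k (traject (nth 0%N c) (nth 0%N c k) 20)).+1.

(** One entry for each cycle of c on the faces: the order of the first power of c
that fixes the base of the cycle. *)
Definition holonomy_orders c :=
  [seq code_order (code_pow c (cycle_len c k)) | k <- code_id & cycle_root c k == k].

(** By rows: the identity, rotations of order 5, 3 and 2, then -1, rotary
reflections of order 10 and 6, and mirror reflections. *)
Definition orders_table : seq (nat * seq nat) :=
  [:: (1%N, nseq 20 1%N); (24, nseq 4 1%N); (20, nseq 6 1%N ++ nseq 2 3);
    (15, nseq 10 1%N); (1%N, nseq 10 1%N); (24, nseq 2 1%N);
    (20, nseq 3 1%N ++ nseq 1 3); (15, nseq 8 1%N ++ nseq 4 2)]%N.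

(** The tables serve in closed boolean tests only, and would swamp any goal in
which simplification unfolded them. *)
Opaque codes triangles znormals face_gens vertex_gens.
Arguments stab_pairs : simpl never.
Arguments conjugate : simpl never.
Arguments cycle_root : simpl never.
Arguments cycle_pos : simpl never.
Arguments cycle_len : simpl never.
Arguments code_order : simpl never.

Lemma all_iotaP (p : pred nat) n : all p (iota 0 n) -> forall k, (k < n)%N -> p k.
Proof. by move=> /allP pn k kn; apply: pn; rewrite mem_iota. Qed.

Lemma closure_ind (S T : eqType) (step : S -> T -> T) gens x (P : T -> Prop) :
  P x -> {in gens, forall g y, P y -> P (step g y)} ->
  forall n y, y \in closure step gens x n -> P y.
Proof.
move=> Px Pstep; elim=> [|n IHn] y /=; first by rewrite inE => /eqP ->.
rewrite mem_undup mem_cat => /orP[/IHn//|/allpairsP[[g z] [/= gg zL ->]]].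
exact: Pstep gg _ (IHn _ zL).
Qed.

Lemma codesE : codes = closure code_comp face_gens code_id 15.
Proof. by vm_compute. Qed.

Lemma codes_ind (P : seq nat -> Prop) :
  P code_id -> {in face_gens, forall g c, P c -> P (code_comp g c)} -> forall c, c \in codes -> P c.
Proof. by move=> P1 Pg c; rewrite codesE; move: c; exact: closure_ind. Qed.

Definition valid (c : seq nat) := perm_eq c code_id.

Lemma codes_valid c : c \in codes -> valid c.
Proof. by apply/allP: c; vm_compute. Qed.

Lemma face_gens_valid c : c \in face_gens -> valid c.
Proof. by apply/allP: c; vm_compute. Qed.

Lemma size_valid c : valid c -> size c = 20.
Proof. by move=> /perm_size. Qed.

Lemma ltn_valid c k : valid c -> (k < 20)%N -> (nth 0%N c k < 20)%N.
Proof.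
move=> vc k20; have: nth 0%N c k \in c by rewrite mem_nth// size_valid.
by rewrite (perm_mem vc) mem_iota.
Qed.

Lemma nth_code_comp c d k : valid d -> (k < 20)%N ->
  nth 0%N (code_comp c d) k = nth 0%N c (nth 0%N d k).
Proof. by move=> vd k20; rewrite (nth_map 0%N)// size_valid. Qed.

Lemma code_compA c d e : valid d -> valid e ->
  code_comp (code_comp c d) e = code_comp c (code_comp d e).
Proof.
move=> vd ve; rewrite /code_comp -map_comp; apply/eq_in_map => x /=.
by rewrite (perm_mem ve) mem_iota => /= x20; rewrite -/(code_comp c d) nth_code_comp.
Qed.

Lemma code_comp1 c : valid c -> code_comp code_id c = c.
Proof.
move=> vc; rewrite -[RHS]map_id; apply/eq_in_map => x.
by rewrite (perm_mem vc) mem_iota => /= x20; rewrite nth_iota.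
Qed.

Lemma codes_id : code_id \in codes.
Proof. by vm_compute. Qed.

Lemma codes_comp_gen : {in face_gens & codes, forall g c, code_comp g c \in codes}.
Proof.
have: all (fun g => all (fun c => code_comp g c \in codes) codes) face_gens by vm_compute.
by move=> /allP h g c /h /allP; apply.
Qed.

Lemma face_gens_codes c : c \in face_gens -> c \in codes.
Proof. by apply/allP: c; vm_compute. Qed.

(** Only products with a generator on the left are tabulated; induction on the
first factor does the rest. *)
Lemma codes_comp : {in codes &, forall c d, code_comp c d \in codes}.
Proof.
move=> c d cL dL; suff [] : c \in codes /\ code_comp c d \in codes by [].
move: c cL; apply: codes_ind.
  by rewrite codes_id code_comp1//; exact: codes_valid.
move=> g gg e [eL edL]; split; first exact: codes_comp_gen.
by rewrite code_compA; [exact: codes_comp_gen|exact: codes_valid..].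
Qed.

Lemma codes_inv c : c \in codes -> exists2 d, d \in codes & code_comp c d = code_id.
Proof.
have: all (fun c => has (fun d => code_comp c d == code_id) codes) codes by vm_compute.
by move=> /allP h /h /hasP[d dL /eqP]; exists d.
Qed.

Lemma codes_uniq : uniq codes.
Proof. by vm_compute. Qed.

Lemma mem_stab_pairs n c k : ((c, k) \in stab_pairs n) =
  [&& nth 0%N c k == k, c \in codes, code_order c == n & (k < 20)%N].
Proof.
rewrite /stab_pairs mem_filter; congr andb.
apply/allpairsP/and3P => [[[c' k'] [/= ]]|[cL cn k20]].
  by rewrite mem_filter mem_iota => /andP[cn cL] k20 [-> ->].
by exists (c, k); split=> //=; rewrite ?mem_filter ?cn// mem_iota.
Qed.

(** The stabiliser of a face is dihedral of order 6, in which all reflections are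
conjugate and a reflection exchanges the two rotations; moreover the group is
transitive on faces. *)
Lemma stab_pairs_conjugate n : n \in [:: 2; 3]%N ->
  exists2 o, o \in stab_pairs n & {in stab_pairs n, forall p, conjugate o p}.
Proof.
have: all (fun n => let s := stab_pairs n in let o := head ([::], 0%N) s in
  (o \in s) && all (conjugate o) s) [:: 2; 3]%N by vm_compute.
move=> /allP h /h /andP[oL /allP hn]; by exists (head ([::], 0%N) (stab_pairs n)).
Qed.

Lemma holonomy_tally :
  perm_eq [seq sort leq (holonomy_orders c) | c <- codes]
          (flatten [seq nseq p.1 p.2 | p <- orders_table]).
Proof. by vm_compute. Qed.

(** The five facts about bases, positions and lengths of cycles under which
[card_equivariant] counts the fixed tilings. *)
Lemma cycles_correct c k (f := nth 0%N c) : c \in codes -> (k < 20)%N ->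
  [/\ cycle_root c (f k) = cycle_root c k,
      iter (cycle_pos c k) f (cycle_root c k) = k,
      cycle_root c k = k -> cycle_pos c k = 0%N,
      iter (cycle_len c k) f k = k &
      (f k = cycle_root c k /\ (cycle_pos c k).+1 = cycle_len c (f k)) \/
      cycle_pos c (f k) = (cycle_pos c k).+1].
Proof.
have: all (fun c => all (fun k => let f := nth 0%N c in
  [&& cycle_root c (f k) == cycle_root c k, iter (cycle_pos c k) f (cycle_root c k) == k,
      (cycle_root c k == k) ==> (cycle_pos c k == 0%N), iter (cycle_len c k) f k == k &
      (f k == cycle_root c k) && ((cycle_pos c k).+1 == cycle_len c (f k)) ||
      (cycle_pos c (f k) == (cycle_pos c k).+1)]) code_id) codes by vm_compute.
move=> /allP h /h /(@all_iotaP _ 20) hc /hc /and5P[/eqP h1 /eqP h2 /implyP h3 /eqP h4 h5].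
split=> //; first by move=> /eqP /h3 /eqP.
by case/orP: h5 => [/andP[/eqP ? /eqP ?]|/eqP ?]; [left|right].
Qed.

Lemma cycle_root_lt c k : c \in codes -> (k < 20)%N -> (cycle_root c k < 20)%N.
Proof.
have: all (fun c => all (fun k => cycle_root c k < 20)%N code_id) codes by vm_compute.
by move=> /allP h /h /(@all_iotaP _ 20); apply.
Qed.

Lemma holonomy_order_cases c k : c \in codes -> (k < 20)%N -> cycle_root c k = k ->
  code_order (code_pow c (cycle_len c k)) \in [:: 1; 2; 3]%N.
Proof.
have: all (fun c => all (fun k => (cycle_root c k == k) ==>
  (code_order (code_pow c (cycle_len c k)) \in [:: 1; 2; 3]%N)) code_id) codes by vm_compute.
by move=> /allP h /h /(@all_iotaP _ 20) hc /hc /implyP hk /eqP /hk.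
Qed.

Lemma sum_codes (w : nat -> nat) :
  (\sum_(c <- codes) \prod_(n <- holonomy_orders c) w n =
   w 1 ^ 20 + 24 * w 1 ^ 4 + 20 * (w 1 ^ 6 * w 3 ^ 2) + 15 * w 1 ^ 10 + w 1 ^ 10 +
   24 * w 1 ^ 2 + 20 * (w 1 ^ 3 * w 3) + 15 * (w 1 ^ 8 * w 2 ^ 4))%N.
Proof.
under eq_bigr do rewrite -(perm_big _ (permEl (perm_sort leq _))) /=.
rewrite -(big_map (fun c => sort leq (holonomy_orders c)) xpredT (fun l => \prod_(n <- l) w n)%N).
rewrite (perm_big _ holonomy_tally) big_flatten big_map /orders_table.
under eq_bigr do rewrite big_nseq iter_addn_0.
by rewrite unlock /=; ring.
Qed.

(** * The icosahedral group and its action on the face normals *)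

Section Realisation.
Variable R : realType.
Local Notation phi := (phi R).

Lemma phi_sqr : phi * phi = phi + 1.
Proof.
have h : Num.sqrt 5 * Num.sqrt 5 = 5 :> R by rewrite -expr2 sqr_sqrtr.
rewrite /Defs.phi; lra.
Qed.

Lemma phi_gt1 : 1 < phi.
Proof.
have : 1 < Num.sqrt 5 :> R by rewrite -[ltLHS]sqrtr1 ltr_sqrt; lra.
rewrite /Defs.phi; lra.
Qed.

(** The ring morphism from golden integers to R. *)
Definition zval (x : zphi) : R := x.1%:~R + x.2%:~R * phi.

Lemma zvalD x y : zval (zadd x y) = zval x + zval y.
Proof. by rewrite /zval /= !intrD; ring. Qed.

Lemma zvalM x y : zval (zmul x y) = zval x * zval y.
Proof. by rewrite /zval /= !intrD !intrM; ring: phi_sqr. Qed.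

Lemma zval_neq0 x : znorm x != 0 -> zval x != 0.
Proof.
apply: contra_neq => x0; apply/eqP; rewrite -(intr_eq0 R).
have -> : (znorm x)%:~R = zval x * (x.1%:~R + x.2%:~R - x.2%:~R * phi).
  rewrite /znorm /zval !intrD mulrNz !intrM; ring: phi_sqr.
by rewrite x0 mul0r.
Qed.

Definition zcol (u : seq zphi) : 'cV[R]_3 := \col_i zval (zcoord u i).

Lemma dot_zcol u v : dot (zcol u) (zcol v) = zval (zdot u v).
Proof.
rewrite /dot mxE !big_ord_recl big_ord0 !mxE /= /bump /= /zdot !zvalD !zvalM.
by rewrite addr0 addrA.
Qed.

Lemma zcolD u v : zcol (zvadd u v) = zcol u + zcol v.
Proof. by apply/matrixP => -[[|[|[|]]]//= ?] j; rewrite !mxE/= zvalD. Qed.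

Lemma zcolZ c u : zcol (zscale c u) = zval c *: zcol u.
Proof. by apply/matrixP => -[[|[|[|]]]//= ?] j; rewrite !mxE/= zvalM. Qed.

Definition generator k : 'M[R]_3 := nth 1%:M [:: R0 R; R1 R; R2 R] k.

Lemma generatorE k i j : (k < 3)%N ->
  2 * generator k i j = zval (zcoord (nth [::] (nth [::] zgens k) i) j).
Proof.
by case: k => [|[|[|//]]] _; case: i => -[|[|[|//]]] ?; case: j => -[|[|[|//]]] ?;
  rewrite !mxE/= /zval/= ?mulrNz; field.
Qed.

Lemma generator_zcol k u : (k < 3)%N ->
  2 *: (generator k *m zcol u) = zcol (zapply (nth [::] zgens k) u).
Proof.
move=> k3; apply/matrixP => i j; rewrite ord1 !mxE mulr_sumr.
under eq_bigr do rewrite mulrA (generatorE _ _ k3) mxE -zvalM.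
rewrite !big_ord_recl big_ord0 addr0 addrA -!zvalD.
by case: i => -[|[|[|//]]].
Qed.

Lemma generator_double k u v : (k < 3)%N -> zapply (nth [::] zgens k) u = double v ->
  generator k *m zcol u = zcol v.
Proof.
move=> k3 e; apply: (@scalerI _ _ 2); rewrite ?pnatr_eq0//.
by rewrite generator_zcol// e zcolZ /zval /= mul0r addr0.
Qed.

Definition vertex i : 'cV[R]_3 := zcol (zvertex i).
Definition normal k : 'cV[R]_3 := zcol (znormal k).

Lemma generator_normal k j : (k < 3)%N -> (j < 20)%N ->
  generator k *m normal j = normal (nth 0%N (nth [::] face_gens k) j).
Proof.
have : all (fun k => all (fun j => zapply (nth [::] zgens k) (znormal j) ==
  double (znormal (nth 0%N (nth [::] face_gens k) j))) (iota 0 20)) (iota 0 3) by vm_compute.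
by move=> /all_iotaP h k3 /(all_iotaP (h _ k3)) /eqP; exact: generator_double.
Qed.

Lemma generator_vertex k j : (k < 3)%N -> (j < 12)%N ->
  generator k *m vertex j = vertex (nth 0%N (nth [::] vertex_gens k) j).
Proof.
have : all (fun k => all (fun j => zapply (nth [::] zgens k) (zvertex j) ==
  double (zvertex (nth 0%N (nth [::] vertex_gens k) j))) (iota 0 12)) (iota 0 3) by vm_compute.
by move=> /all_iotaP h k3 /(all_iotaP (h _ k3)) /eqP; exact: generator_double.
Qed.

Lemma generator_tr k : (k < 3)%N -> (generator k)^T = generator k.
Proof.
move=> k3; apply/matrixP => i j; rewrite mxE; apply: (@mulfI _ 2); rewrite ?pnatr_eq0//.
rewrite !generatorE//; congr zval.
have : all (fun k => all (fun i => all (fun j => zcoord (nth [::] (nth [::] zgens k) j) i ==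
   zcoord (nth [::] (nth [::] zgens k) i) j) (iota 0 3)) (iota 0 3)) (iota 0 3) by vm_compute.
by move=> /all_iotaP/(_ _ k3)/all_iotaP/(_ _ (ltn_ord i))/all_iotaP/(_ _ (ltn_ord j))/eqP.
Qed.

Lemma zcramerE u v w x :
  zcol (zcramer u v w x) = zval (zdet u v w) *: zcol x.
Proof.
apply/matrixP => -[[|[|[|]]]//= ?] j;
  rewrite !mxE/= /zdet /zdot /zcramer /zcross /zcoord /= !(zvalD, zvalM) /zval /= ; ring.
Qed.

(** A linear map that kills a basis is zero.  This form serves for matrices that
agree on three normals as well as for planes that share three points. *)
Lemma zcol_free m (d : 'M[R]_(m, 3)) u v w : znorm (zdet u v w) != 0 ->
  d *m zcol u = 0 -> d *m zcol v = 0 -> d *m zcol w = 0 -> d = 0.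
Proof.
move=> /zval_neq0 D0 du dv dw.
have dx x : d *m zcol x = 0.
  apply: (scalerI D0); rewrite scaler0 scalemxAr -zcramerE.
  by rewrite !zcolD !zcolZ !mulmxDr -!scalemxAr du dv dw !scaler0 !addr0.
apply/matrixP => i j; rewrite mxE.
have := congr1 (fun x : 'cV_m => x i 0) (dx (zvec (fun l => ((l == j)%:Z, 0)))).
rewrite mxE [RHS]mxE (bigD1 j)//= big1 => [|l lj]; rewrite !mxE.
  by case: j => -[|[|[|//]]] ?; rewrite /zval /= mul0r !addr0 mulr1.
case: j l lj => -[|[|[|//]]] ? [[|[|[|//]]] ?] //= _; by rewrite /zval /= mul0r !addr0 mulr0.
Qed.

Local Notation Ih := (Ih R).

Lemma znormal_free : znorm (zdet (znormal 0) (znormal 1) (znormal 2)) != 0.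
Proof. by vm_compute. Qed.

Lemma normal_free m (d : 'M[R]_(m, 3)) :
  (forall k, (k < 20)%N -> d *m normal k = 0) -> d = 0.
Proof. by move=> h; apply: (zcol_free znormal_free); exact: h. Qed.

Lemma corners_free k m (d : 'M[R]_(m, 3)) : (k < 20)%N ->
  (forall i, (i < 3)%N -> d *m vertex (corner k i) = 0) -> d = 0.
Proof.
have : all (fun k => znorm (zdet (zvertex (corner k 0)) (zvertex (corner k 1))
  (zvertex (corner k 2))) != 0) (iota 0 20) by vm_compute.
by move=> /all_iotaP h /h D0 hd; apply: (zcol_free D0); exact: hd.
Qed.

Lemma generator_sqr k : (k < 3)%N -> generator k *m generator k = 1%:M.
Proof.
move=> k3; apply/subr0_eq/normal_free => j j20.
rewrite mulmxBl -mulmxA mul1mx !generator_normal//; last first.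
  by apply: ltn_valid => //; apply: face_gens_valid; rewrite mem_nth.
have : all (fun k => all (fun j => nth 0%N (nth [::] face_gens k)
  (nth 0%N (nth [::] face_gens k) j) == j) (iota 0 20)) (iota 0 3) by vm_compute.
by move=> /all_iotaP/(_ _ k3)/all_iotaP/(_ _ j20)/eqP ->; rewrite subrr.
Qed.

Lemma Ih_ind (G : set 'M[R]_3) :
  matrix_group G -> (forall k, (k < 3)%N -> G (generator k)) -> Ih `<=` G.
Proof.
move=> Gg Gk; apply: smallest_sub => // _ [[->|->]|->].
- exact: Gk 0%N _. - exact: Gk 1%N _. - exact: Gk 2%N _.
Qed.

Lemma Ih_group : matrix_group Ih.
Proof.
split.
- by move=> G [[G1 _ _] _].
- by move=> a b ha hb G hG; case: (hG) => -[_ GM _] _; apply: GM; [exact: ha|exact: hb].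
- move=> a ha; split; last by move=> G hG; case: (hG) => -[_ _ GV] _; have [] := GV _ (ha _ hG).
  apply: (@Ih_ind [set x | x \in unitmx]) ha => [|k k3]; last first.
    by have [] := mulmx1_unit (generator_sqr k3).
  split=> /= [|x y ux uy|x ux]; first exact: unitmx1.
    by rewrite unitmx_mul ux.
  by rewrite unitmx_inv.
Qed.

Lemma Ih_generator k : (k < 3)%N -> Ih (generator k).
Proof.
move=> k3; apply: sub_gen_smallest.
by case: k k3 => [|[|[|//]]] _; [left; left|left; right|right].
Qed.

Lemma Ih_orthogonal a : Ih a -> a^T *m a = 1%:M.
Proof.
apply: (@Ih_ind [set a | a^T *m a = 1%:M]) => [|k k3]; last first.
  by rewrite /= generator_tr// generator_sqr.
split=> /=; first by rewrite trmx1 mulmx1.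
  by move=> x y hx hy; rewrite trmx_mul -mulmxA (mulmxA _ x) hx mul1mx.
move=> x hx; have [_ ux] := mulmx1_unit hx; split=> //.
have -> : invmx x = x^T by rewrite -[LHS]mul1mx -hx mulmxK.
by rewrite trmxK; exact: mulmx1C.
Qed.

Lemma Ih_dot a u v : Ih a -> dot (a *m u) (a *m v) = dot u v.
Proof. by move=> /Ih_orthogonal h; rewrite /dot trmx_mul mulmxA -(mulmxA _ _ a) h mulmx1. Qed.

(** The dictionary between the matrix group and the coded permutations. *)
Definition realises (a : 'M[R]_3) (c : seq nat) :=
  forall k, (k < 20)%N -> a *m normal k = normal (nth 0%N c k).

Lemma realises1 : realises 1%:M code_id.
Proof. by move=> k k20; rewrite mul1mx nth_iota. Qed.

Lemma realisesM a b c d : valid d ->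
  realises a c -> realises b d -> realises (a *m b) (code_comp c d).
Proof.
move=> vd ac bd k k20; rewrite -mulmxA bd// nth_code_comp// ac//; exact: ltn_valid.
Qed.

(** The normals span R ^ 3. *)
Lemma realises_inj a b c : realises a c -> realises b c -> a = b.
Proof.
move=> ac bc; apply/subr0_eq/normal_free => k k20.
by rewrite mulmxBl ac// bc// subrr.
Qed.

Lemma codes_realised c : c \in codes -> exists2 a, Ih a & realises a c.
Proof.
move=> cL; suff [] : c \in codes /\ exists2 a, Ih a & realises a c by [].
move: c cL; apply: codes_ind.
  by split; [exact: codes_id|exists 1%:M; [by case: Ih_group|exact: realises1]].
move=> g gg c [cL [a Ia ac]]; split; first exact: codes_comp_gen.
have k3 : (index g face_gens < 3)%N by rewrite index_mem.
exists (generator (index g face_gens) *m a).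
  by case: Ih_group => _ IM _; apply: IM => //; exact: Ih_generator.
apply: realisesM => //; first exact: codes_valid.
by move=> j j20; rewrite generator_normal// nth_index.
Qed.

(** The matrices that permute the normals as some listed code form a group,
because the list is closed under products and inverses, and this group contains
the generators. *)
Lemma Ih_code a : Ih a -> exists2 c, c \in codes & realises a c.
Proof.
suff h : Ih `<=` [set a | a \in unitmx /\ exists2 c, c \in codes & realises a c].
  by move=> /h[].
apply: Ih_ind => [|k k3]; last first.
  split; first by have [] := mulmx1_unit (generator_sqr k3).
  exists (nth [::] face_gens k); last by move=> j; exact: generator_normal.
  by apply: face_gens_codes; rewrite mem_nth.
split=> /=.
- by split; [exact: unitmx1|exists code_id; [exact: codes_id|exact: realises1]].
- move=> x y [ux [c cL xc]] [uy [d dL yd]]; split; first by rewrite unitmx_mul ux.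
  exists (code_comp c d); first exact: codes_comp.
  by apply: realisesM => //; exact: codes_valid.
move=> x [ux [c cL xc]]; split=> //; split; first by rewrite unitmx_inv.
have [d dL cd] := codes_inv cL; exists d => //.
have [y _ yd] := codes_realised dL.
suff -> : invmx x = y by [].
have xy : x *m y = 1%:M.
  by apply: realises_inj realises1; rewrite -cd; apply: realisesM => //; exact: codes_valid.
by rewrite -[RHS](mulKmx ux) xy mulmx1.
Qed.

End Realisation.

(** * The icosahedron and its faces *)

Section Polyhedron.
Variable R : realType.
Local Notation phi := (phi R).
Local Notation Ih := (Ih R).
Local Notation icosahedron := (icosahedron R).
Local Notation vertex := (@vertex R).
Local Notation normal := (@normal R).

Lemma base_vertexE : base_vertex R = vertex 0.
Proof.
apply/matrixP => -[[|[|[|//]]] ?] j; rewrite !mxE /zval /=; ring.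
Qed.

Lemma vertex_gens_lt g i : g \in vertex_gens -> (i < 12)%N -> (nth 0%N g i < 12)%N.
Proof.
have : all (fun g => all (fun i => nth 0%N g i < 12)%N (iota 0 12)) vertex_gens by vm_compute.
by move=> /allP h /h /all_iotaP; apply.
Qed.

Lemma vertex_orbit i : (i < 12)%N -> exists2 a, Ih a & vertex i = a *m base_vertex R.
Proof.
have [I1 IM _] := Ih_group R.
have : all (mem (closure (nth 0%N) vertex_gens 0%N 15)) (iota 0 12) by vm_compute.
move=> /all_iotaP h /h iL.
suff [] : (i < 12)%N /\ exists2 a, Ih a & vertex i = a *m base_vertex R by [].
move: i iL {h}; apply: closure_ind.
  by split=> //; exists 1%:M => //; rewrite mul1mx base_vertexE.
move=> g gg i [i12 [a Ia via]].
have k3 : (index g vertex_gens < 3)%N by rewrite index_mem.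
split; first exact: vertex_gens_lt.
exists (@generator R (index g vertex_gens) *m a).
  by apply: IM => //; exact: Ih_generator.
by rewrite -mulmxA -via generator_vertex// nth_index.
Qed.

(** Stability of the vertex set is demanded of the inverse as well, which makes
the condition define a group without a finiteness argument. *)
Lemma Ih_vertex a : Ih a ->
  forall i, (i < 12)%N -> exists2 j, (j < 12)%N & a *m vertex i = vertex j.
Proof.
pose stable (x : 'M[R]_3) :=
  forall i, (i < 12)%N -> exists2 j, (j < 12)%N & x *m vertex i = vertex j.
suff h : Ih `<=` [set x | [/\ x \in unitmx, stable x & stable (invmx x)]] by move=> /h[].
apply: Ih_ind => [|k k3]; last first.
  have gs := generator_sqr R k3.
  have [gu _] := mulmx1_unit gs.
  have gS : stable (@generator R k).
    move=> i i12; exists (nth 0%N (nth [::] vertex_gens k) i); last exact: generator_vertex.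
    by apply: vertex_gens_lt; rewrite ?mem_nth.
  split=> //.
  suff -> : invmx (@generator R k) = @generator R k by [].
  by rewrite -[RHS](mulKmx gu) gs mulmx1.
have stableM x y : stable x -> stable y -> stable (x *m y).
  by move=> xs ys i /ys[j j12 yi]; have [l l12 xj] := xs _ j12; exists l; rewrite // -mulmxA yi.
split=> /=.
- by split; rewrite ?unitmx1 ?invmx1// => i i12; exists i; rewrite // mul1mx.
- move=> x y [ux sx sx'] [uy sy sy']; split; first by rewrite unitmx_mul ux.
    exact: stableM.
  have -> : invmx (x *m y) = invmx y *m invmx x.
    by rewrite -[RHS]mulmx1 -(mulmxV (_ : x *m y \in unitmx)) ?unitmx_mul ?ux//
      mulmxA -[_ *m (x *m y)]mulmxA mulKmx// mulVmx// mul1mx.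
  exact: stableM.
by move=> x [ux sx sx']; split=> //; split; rewrite ?unitmx_inv ?invmxK.
Qed.

Lemma icosahedron_vertex i : (i < 12)%N -> icosahedron (vertex i).
Proof. by move=> /vertex_orbit[a Ia ->]; apply: sub_gen_smallest; exists a. Qed.

(** The convex combinations of the vertices form a convex set that contains the
orbit of the base vertex. *)
Lemma icosahedron_conv x : icosahedron x ->
  exists c : 'I_12 -> R, [/\ forall i, 0 <= c i, \sum_i c i = 1 &
    x = \sum_i c i *: vertex i].
Proof.
move: x; apply: (@smallest_sub _ (@convex_set R 'cV[R]_3) _
  [set x | exists c : 'I_12 -> R, [/\ forall i, 0 <= c i, \sum_i c i = 1 &
    x = \sum_i c i *: vertex i]]).
  move=> x y t /[!inE] /= -[c [c0 c1 ->]] [d [d0 d1 ->]].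
  have t0 : 0 <= t%:num by []. have t1 : t%:num <= 1 by [].
  exists (fun i => t%:num * c i + (1 - t%:num) * d i); split.
  - by move=> i; rewrite addr_ge0// mulr_ge0// subr_ge0.
  - by rewrite big_split/= -!mulr_sumr c1 d1 !mulr1 addrC subrK.
  - rewrite /conv/= !scaler_sumr -big_split/=.
    by apply: eq_bigr => i _; rewrite [in RHS]scalerDl !scalerA.
move=> _ [a Ia <-]; rewrite base_vertexE.
have [//|j j12 ->] := Ih_vertex Ia (i := 0).
exists (fun i => (i == Ordinal j12)%:R); split=> [i||]; first by rewrite ler0n.
  by rewrite (bigD1 (Ordinal j12))//= eqxx big1 ?addr0// => i /negPf->.
rewrite (bigD1 (Ordinal j12))//= eqxx big1 ?addr0 ?scale1r// => i /negPf->.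
by rewrite scale0r.
Qed.

Lemma Ih_icosahedron a x : Ih a -> icosahedron x -> icosahedron (a *m x).
Proof.
have [_ IM _] := Ih_group R.
move=> Ia; move: x; apply: (@smallest_sub _ (@convex_set R 'cV[R]_3) _
   [set x | icosahedron (a *m x)]).
  move=> x y t /[!inE] /= Px Py G [Gc hG].
  have := Gc (a *m x) (a *m y) t; rewrite !inE => /(_ (Px G (conj Gc hG)) (Py G (conj Gc hG))).
  by rewrite /conv/= mulmxDr -!scalemxAr.
move=> _ [b Ib <-] /=; rewrite mulmxA; apply: sub_gen_smallest; exists (a *m b) => //.
exact: IM.
Qed.

Local Notation beta := (@zval R face_value).

Definition face_set k : set 'cV[R]_3 := [set x | icosahedron x /\ dot (normal k) x = beta].

Lemma znormal_vertex k i : (k < 20)%N -> (i < 12)%N ->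
  (if i \in nth [::] triangles k then zdot (znormal k) (zvertex i) = face_value
   else zdot (znormal k) (zvertex i) \in [:: (0, 1); (0, -1); (- 2%:Z, - 3%:Z)]).
Proof.
have : all (fun k => all (fun i => if i \in nth [::] triangles k
   then zdot (znormal k) (zvertex i) == face_value
   else zdot (znormal k) (zvertex i) \in [:: (0, 1); (0, -1); (- 2%:Z, - 3%:Z)])
   (iota 0 12)) (iota 0 20) by vm_compute.
by move=> /all_iotaP h /h /all_iotaP h' /h'; case: ifP => // _ /eqP.
Qed.

Lemma face_value_gt0 : 0 < beta.
Proof. by rewrite /zval /=; have := phi_gt1 R; lra. Qed.

(** Off the corners of k the inner products are phi, - phi and - 3 phi - 2, all
below 3 phi + 2; so the plane of k supports the polyhedron. *)
Lemma dot_normal_vertex k i : (k < 20)%N -> (i < 12)%N ->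
  if i \in nth [::] triangles k then dot (normal k) (vertex i) = beta
  else dot (normal k) (vertex i) < beta.
Proof.
move=> k20 i12; rewrite dot_zcol; have := znormal_vertex k20 i12.
case: ifP => _; first by move=> ->.
have := phi_gt1 R.
by rewrite !inE => p1 /or3P[] /eqP ->; rewrite /zval /= ?mulrNz; lra.
Qed.

Lemma icosahedron_le (n : 'rV[R]_3) b :
  (forall i, (i < 12)%N -> (n *m vertex i) 0 0 <= b) ->
  forall x, icosahedron x -> (n *m x) 0 0 <= b.
Proof.
move=> nb x /icosahedron_conv[c [c0 c1 ->]].
rewrite mulmx_sumr summxE -[b]mul1r -c1 mulr_suml; apply: ler_sum => i _.
by rewrite -scalemxAr mxE ler_wpM2l// nb.
Qed.

Lemma corner_lt k i : (k < 20)%N -> (i < 3)%N -> (corner k i < 12)%N.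
Proof.
have : all (fun k => all (fun i => corner k i < 12)%N (iota 0 3)) (iota 0 20) by vm_compute.
by move=> /all_iotaP h /h /all_iotaP; apply.
Qed.

Lemma corner_mem k i : (k < 20)%N -> (i < 3)%N -> corner k i \in nth [::] triangles k.
Proof.
have : all (fun k => all (fun i => corner k i \in nth [::] triangles k) (iota 0 3)) (iota 0 20).
  by vm_compute.
by move=> /all_iotaP h /h /all_iotaP; apply.
Qed.

Lemma corner_face k i : (k < 20)%N -> (i < 3)%N -> face_set k (vertex (corner k i)).
Proof.
move=> k20 i3; split; first by apply: icosahedron_vertex; exact: corner_lt.
by have := dot_normal_vertex k20 (corner_lt k20 i3); rewrite corner_mem//.
Qed.

(** Three linearly independent points are affinely independent. *)
Lemma rank_edges_free (p q r : 'cV[R]_3) :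
  (forall d : 'rV[R]_3, d *m p = 0 -> d *m q = 0 -> d *m r = 0 -> d = 0) ->
  \rank (row_mx (q - p) (r - p)) = 2%N.
Proof.
move=> h; pose B : 'M[R]_3 := row_mx p (row_mx q r : 'M[R]_(3, 2)).
have mulB m (d : 'M[R]_(m, 3)) : d *m B = row_mx (d *m p) (row_mx (d *m q) (d *m r)).
  by rewrite -(mul_mx_row d q r) -(mul_mx_row d p).
have Bu : B \in unitmx.
  rewrite -row_free_unit -kermx_eq0; apply/eqP/row_matrixP => i; rewrite row0.
  set d := row i _.
  have : row_mx (d *m p) (row_mx (d *m q) (d *m r)) = row_mx 0 (row_mx 0 0).
    by rewrite -mulB !row_mx0 -row_mul mulmx_ker row0.
  by move=> /eq_row_mx[dp /eq_row_mx[]]; exact: h.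
pose c : 'rV[R]_(1 + 1) := row_mx (- 1)%:M (- 1)%:M.
pose C : 'M[R]_(3, 2) := col_mx c 1%:M.
have -> : row_mx (q - p) (r - p) = B *m C.
  have pc : p *m c = row_mx (- p) (- p) by rewrite mul_mx_row mul_mx_scalar scaleN1r.
  transitivity (row_mx (- p) (- p) + row_mx q r); first by rewrite add_row_mx ![- p + _]addrC.
  by rewrite -pc -[row_mx q r in LHS]mulmx1; exact/esym/(mul_row_col p).
apply/eqP; rewrite eqn_leq rank_leq_col /=.
rewrite -[X in (X <= _)%N](@mxrank1 R 2).
pose D : 'M[R]_(2, 3) := row_mx (0 : 'cV[R]_2) 1%:M.
have <- : (D *m invmx B) *m (B *m C) = 1%:M.
  by rewrite mulmxA mulmxKV// [LHS](mul_row_col (0 : 'cV_2)) mul0mx add0r mulmx1.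
exact: mxrankM_maxr.
Qed.

Lemma is_face_face_set k : (k < 20)%N -> is_face icosahedron (face_set k).
Proof.
move=> k20; have cF := corner_face k20; split.
  exists (normal k)^T, beta; split=> //.
    apply/eqP => n0; have := (cF 0%N isT).2; rewrite /dot n0 mul0mx mxE => b0.
    by have := face_value_gt0; rewrite -b0 ltxx.
  apply: icosahedron_le => i i12; have := dot_normal_vertex k20 i12.
  by case: ifP => _; [move=> <-; exact: lexx|exact: ltW].
exists (vertex (corner k 0)), (vertex (corner k 1)), (vertex (corner k 2)).
split; [exact: cF..|]; apply: rank_edges_free => d d0 d1 d2.
by apply: (corners_free k20) => -[|[|[|]]].
Qed.

Lemma face_set_inj j k : (j < 20)%N -> (k < 20)%N -> face_set j = face_set k -> j = k.
Proof.
move=> j20 k20 jk; apply/eqP; rewrite -(nth_uniq [::] _ _ (_ : uniq triangles))//.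
have h : {in iota 0 12, nth [::] triangles j =i nth [::] triangles k}.
  move=> i; rewrite mem_iota /= => i12.
  have := dot_normal_vertex j20 i12; have := dot_normal_vertex k20 i12.
  have : face_set j (vertex i) <-> face_set k (vertex i) by rewrite jk.
  case: ifP => ik; case: ifP => ij //=.
    by move=> [_ fji] ki; have [_ ->] := fji (conj (icosahedron_vertex i12) ki); rewrite ltxx.
  by move=> [fij _] kj ji; move: kj;
    have [_ ->] := fij (conj (icosahedron_vertex i12) ji); rewrite ltxx.
have : all (fun j => all (fun k => all (fun i => (i \in nth [::] triangles j) ==
   (i \in nth [::] triangles k)) (iota 0 12) ==> (nth [::] triangles j == nth [::] triangles k))
  (iota 0 20)) (iota 0 20) by vm_compute.
move=> /all_iotaP/(_ _ j20)/all_iotaP/(_ _ k20)/implyP; apply.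
by apply/allP => i i12; rewrite h.
Qed.

(** The group is orthogonal, so it carries the height function of the face k to
that of its image. *)
Lemma Ih_face_set a c k : Ih a -> realises a c -> (k < 20)%N ->
  mulmx a @` face_set k = face_set (nth 0%N c k).
Proof.
move=> Ia ac k20; have [_ _ IV] := Ih_group R; have [au Ia'] := IV _ Ia.
apply/seteqP; split=> [_ [x [Px nx] <-]|x [Px nx]].
  split; first exact: Ih_icosahedron.
  by rewrite -ac// Ih_dot.
exists (invmx a *m x); last by rewrite mulKVmx.
split; first exact: Ih_icosahedron.
by rewrite -(Ih_dot _ _ Ia) mulKVmx// ac.
Qed.

Lemma vertex_opp i : (i < 12)%N -> exists2 j, (j < 12)%N & vertex i + vertex j = 0.
Proof.
have : all (fun i => has (fun j => zvadd (zvertex i) (zvertex j) == zvec (fun=> (0, 0)))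
  (iota 0 12)) (iota 0 12) by vm_compute.
move=> /all_iotaP h /h /hasP[j]; rewrite mem_iota => /andP[_ j12] /eqP ij; exists j => //.
by rewrite -zcolD ij; apply/matrixP => -[[|[|[|//]]] ?] l; rewrite !mxE/= /zval mul0r addr0.
Qed.

(** For a pair at distance two in the edge graph, the other diagonal of the
rhombus v, w1, w, w2 joins the two common neighbours w1 and w2 and has the same
direction from the origin to its midpoint. *)
Lemma nonadjacent i j : (i < 12)%N -> (j < 12)%N -> i != j -> ~~ adjacent i j ->
  vertex i + vertex j = 0 \/
  exists w1 w2, [/\ (w1 < 12)%N, (w2 < 12)%N &
    phi *: (vertex i + vertex j) = vertex w1 + vertex w2].
Proof.
have : all (fun i => all (fun j => (i != j) ==> ~~ adjacent i j ==>
    ((zvadd (zvertex i) (zvertex j) == zvec (fun=> (0, 0))) ||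
     has (fun w1 => has (fun w2 => zscale (0, 1) (zvadd (zvertex i) (zvertex j)) ==
       zvadd (zvertex w1) (zvertex w2)) (iota 0 12)) (iota 0 12)))
  (iota 0 12)) (iota 0 12) by vm_compute.
move=> /all_iotaP h /h /all_iotaP {}h /h /implyP {}h /h /implyP {}h /h /orP[/eqP ij|].
  left; rewrite -zcolD ij; apply/matrixP => -[[|[|[|//]]] ?] l.
  - by rewrite !mxE/= /zval mul0r addr0.
  - by rewrite !mxE/= /zval mul0r addr0.
  - by rewrite !mxE/= /zval mul0r addr0.
move=> /hasP[w1]; rewrite mem_iota => /andP[_ w112].
move=> /hasP[w2]; rewrite mem_iota => /andP[_ w212] /eqP e.
right; exists w1, w2; split=> //.
by rewrite -!zcolD -e zcolZ /zval /= add0r mul1r.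
Qed.

Lemma clique_triangle i j l : (i < 12)%N -> (j < 12)%N -> (l < 12)%N ->
  adjacent i j -> adjacent j l -> adjacent i l ->
  exists2 k, (k < 20)%N & forall m, (m < 3)%N -> corner k m \in [:: i; j; l].
Proof.
have : all (fun i => all (fun j => all (fun l => adjacent i j ==> adjacent j l ==>
   adjacent i l ==> has (fun k => all (fun m => corner k m \in [:: i; j; l]) (iota 0 3))
   (iota 0 20)) (iota 0 12)) (iota 0 12)) (iota 0 12) by vm_compute.
move=> /all_iotaP h /h /all_iotaP {}h /h /all_iotaP {}h /h /implyP {}h /h /implyP {}h /h.
move=> /implyP {}h /h /hasP[k]; rewrite mem_iota => /andP[_ k20] /all_iotaP; by exists k.
Qed.

Lemma rank_line (p q r v d : 'cV[R]_3) :
  (exists s : R, p = v + s *: d) -> (exists s : R, q = v + s *: d) ->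
  (exists s : R, r = v + s *: d) -> (\rank (row_mx (q - p) (r - p)) <= 1)%N.
Proof.
move=> [a ->] [b ->] [c ->].
have -> : row_mx (v + b *: d - (v + a *: d)) (v + c *: d - (v + a *: d)) =
    d *m row_mx (b - a)%:M (c - a)%:M.
  rewrite mul_mx_row !mul_mx_scalar !scalerBl; congr row_mx;
  by rewrite opprD addrACA subrr add0r.
exact: leq_trans (mxrankM_maxl _ _) (rank_leq_col _).
Qed.

(** Throughout, n x = b is a supporting plane of the polyhedron. *)
Section Supporting.
Variables (n : 'rV[R]_3) (b : R).
Hypotheses (n0 : n != 0) (nb : forall x, icosahedron x -> (n *m x) 0 0 <= b).
Let ht i := (n *m vertex i) 0 0.

Let ht_le i : (i < 12)%N -> ht i <= b.
Proof. by move=> i12; exact: nb (icosahedron_vertex i12). Qed.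

(** The polyhedron is centrally symmetric and spans R ^ 3. *)
Lemma supporting_gt0 : 0 < b.
Proof.
rewrite ltNge; apply/negP => b0; move/eqP: n0; apply; apply: (@corners_free R 0) => // m m3.
have [j j12 /(congr1 (fun x => (n *m x) 0 0))] := vertex_opp (corner_lt (isT : 0 < 20)%N m3).
rewrite mulmxDr mulmx0 mxE [RHS]mxE => e; apply/matrixP => u v; rewrite !ord1 [RHS]mxE.
have := ht_le (corner_lt (isT : 0 < 20)%N m3); have := ht_le j12; rewrite /ht; lra.
Qed.

(** If phi (v + w) = w1 + w2 with v and w in the plane, then w1 or w2 has height at
least phi b > b. *)
Lemma supporting_adjacent i j : (i < 12)%N -> (j < 12)%N -> i != j ->
  ht i = b -> ht j = b -> adjacent i j.
Proof.
move=> i12 j12 ij hi hj; apply: contraT => /(nonadjacent i12 j12 ij).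
have b0 := supporting_gt0; have p1 := phi_gt1 R.
case=> [|[w1 [w2 [w112 w212]]]] /(congr1 (fun x => (n *m x) 0 0)).
  by rewrite mulmxDr mulmx0 mxE [RHS]mxE -/(ht i) -/(ht j) hi hj; lra.
rewrite -scalemxAr !mulmxDr mxE mxE [RHS]mxE -/(ht i) -/(ht j) -/(ht w1) -/(ht w2) hi hj.
have := ht_le w112; have := ht_le w212; nra.
Qed.

(** The covectors n and (b / face_value) normal_k agree on three independent
corners, hence everywhere. *)
Lemma supporting_triangle i j l : (i < 12)%N -> (j < 12)%N -> (l < 12)%N ->
  i != j -> j != l -> l != i -> ht i = b -> ht j = b -> ht l = b ->
  exists2 k, (k < 20)%N & [set x | icosahedron x /\ (n *m x) 0 0 = b] = face_set k.
Proof.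
move=> i12 j12 l12 ij jl li hi hj hl.
have [||k k20 kc] := @clique_triangle i j l i12 j12 l12 (supporting_adjacent i12 j12 ij hi hj).
- exact: supporting_adjacent.
- by apply: supporting_adjacent => //; rewrite eq_sym.
have b0 := supporting_gt0; have v0 := face_value_gt0.
exists k => //.
have nE : n = (b / beta) *: (normal k)^T.
  apply/subr0_eq/(@corners_free R k) => // m m3.
  have hm : ht (corner k m) = b by have := kc m m3; rewrite !inE => /or3P[] /eqP ->.
  have dm := (corner_face k20 m3).2.
  rewrite mulmxBl -scalemxAl; apply/matrixP => u v; rewrite !ord1.
  rewrite mxE [X in _ + X]mxE [X in _ - X]mxE -/(ht _) -/(dot _ _) hm dm [RHS]mxE.
  by rewrite divfK ?subrr// gt_eqF.
have nx x : (n *m x) 0 0 = b / beta * dot (normal k) x by rewrite nE -scalemxAl mxE.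
apply/seteqP; split=> x [Px /=]; rewrite ?nx => e; split=> //=.
  by apply: (mulfI (_ : b / beta != 0)); rewrite ?e ?divfK ?gt_eqF// divr_gt0.
by rewrite e divfK// gt_eqF.
Qed.

End Supporting.

(** A point of the face is a convex combination of the vertices in the plane.  If
there were at most two of these, the face would lie on a line. *)
Lemma face_classification F : is_face icosahedron F ->
  exists2 k, (k < 20)%N & F = face_set k.
Proof.
move=> [[n [b [n0 nb ->]]] [p [q [r [Fp Fq Fr pqr]]]]].
pose A := [set i : 'I_12 | (n *m vertex i) 0 0 == b]%SET.
have [/card_gt2P[i [j [l [[iA jA lA] [ij jl li]]]]]|A2] := ltnP 2 #|A|.
  move: iA jA lA; rewrite !inE => /eqP hi /eqP hj /eqP hl.
  exact: (supporting_triangle n0 nb (ltn_ord i) (ltn_ord j) (ltn_ord l)).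
(* the default ord0 only fills in when the contact set is empty *)
have [i [j Aij]] : exists i j : 'I_12, {subset A <= [:: i; j]}.
  move: A2; rewrite cardE; case E : (enum A) => [|i [|j [|//]]] _.
  - by exists ord0, ord0 => x; rewrite -mem_enum E.
  - by exists i, i => x; rewrite -mem_enum E !inE => ->.
  - by exists i, j => x; rewrite -mem_enum E.
have line x : icosahedron x /\ (n *m x) 0 0 = b ->
    exists s : R, x = vertex i + s *: (vertex j - vertex i).
  move=> [/icosahedron_conv[c [c0 c1 xE]] hx]; exists (c j).
  (* the nonnegative terms c_m (b - n v_m) add up to b - n x = 0 *)
  have cA l : l \notin A -> c l = 0.
    rewrite inE => lA.
    have : \sum_m c m * (b - (n *m vertex m) 0 0) = 0.
      under eq_bigr do rewrite mulrBr; rewrite sumrB -mulr_suml c1 mul1r.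
      rewrite -[X in X - _]hx xE mulmx_sumr summxE.
      by under eq_bigr do rewrite -scalemxAr mxE; rewrite subrr.
    move=> /psumr_eq0P/(_ l) => /(_ _ isT) /eqP.
    rewrite mulf_eq0 subr_eq0 [b == _]eq_sym (negPf lA) orbF.
    move=> h; apply/eqP/h => m _; rewrite mulr_ge0// subr_ge0.
    exact: nb (icosahedron_vertex (ltn_ord m)).
  apply/eqP; rewrite addrC -subr_eq; apply/eqP.
  rewrite -[X in _ - X]scale1r -c1 scaler_suml xE -sumrB.
  rewrite (bigD1 j)//= -scalerBr big1 ?addr0// => l lj; rewrite -scalerBr.
  have [/Aij|/cA ->] := boolP (l \in A); last by rewrite scale0r.
  by rewrite !inE (negPf lj) orbF => /eqP ->; rewrite subrr scaler0.
by have := rank_line (line _ Fp) (line _ Fq) (line _ Fr); rewrite pqr.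
Qed.

End Polyhedron.

(** * Rotations and reflections of a face *)

Section FaceIsometries.
Variable R : realType.
Local Notation V := 'cV[R]_3.

Lemma dotDr (x y z : V) : dot x (y + z) = dot x y + dot x z.
Proof. by rewrite /dot mulmxDr mxE. Qed.
Lemma dotZr (x y : V) c : dot x (c *: y) = c * dot x y.
Proof. by rewrite /dot -scalemxAr mxE. Qed.
Lemma dotC (x y : V) : dot x y = dot y x.
Proof. by rewrite /dot -[y^T *m x]trmxK trmx_mul trmxK [RHS]mxE. Qed.

Lemma frame_inj F (o u v : V) s t s' t' : planar_frame F o u v ->
  o + s *: u + t *: v = o + s' *: u + t' *: v -> s = s' /\ t = t'.
Proof.
move=> [uu vv uv _] e; split.
  have := congr1 (dot u) e; rewrite !dotDr !dotZr uu uv !mulr0 !mulr1 !addr0.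
  exact: addrI.
have := congr1 (dot v) e; rewrite !dotDr !dotZr vv dotC [dot v u]dotC uv !mulr0 !mulr1 !addr0.
exact: addrI.
Qed.

(** A linear map is determined by its restriction to a face, since the three
corners span R ^ 3. *)
Lemma face_span k m (d : 'M[R]_(m, 3)) : (k < 20)%N ->
  (forall x, face_set k x -> d *m x = 0) -> d = 0.
Proof.
by move=> k20 h; apply: (corners_free k20) => i i3; apply: h; exact: corner_face.
Qed.

Lemma face_not_line k (v d : V) : (k < 20)%N ->
  ~ forall x, face_set k x -> exists s : R, x = v + s *: d.
Proof.
move=> /(is_face_face_set R)[_ [p [q [r [Fp Fq Fr pqr]]]]] h.
by have := rank_line (h _ Fp) (h _ Fq) (h _ Fr); rewrite pqr.
Qed.

(** In the frame of the face, the cube of the map is the rotation by 2 pi, so it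
fixes the face pointwise.  Were the map the identity, the face would be reduced
to the centre of rotation, because cos (2 pi / 3) <> 1. *)
Lemma rotation_cube k (a : 'M[R]_3) : (k < 20)%N ->
  mulmx a @` face_set k = face_set k ->
  is_rotation (2 * pi / 3) (face_set k) (mulmx a) -> a *m a *m a = 1%:M /\ a != 1%:M.
Proof.
move=> k20 aF; set th := 2 * pi / 3; move=> [ctr [u [v [fr rot]]]].
have [_ _ _ span] := fr.
have stab x : face_set k x -> face_set k (a *m x) by rewrite -{2}aF; exists x.
have pi0 := pi_gt0 R.
have c1 : cos th != 1.
  apply/negP => /eqP; rewrite -cos0 => /cos_inj; rewrite !in_itv/= lexx !(ltW pi0).
  have -> : 0 <= th <= pi by rewrite /th; lra.
  by move=> /(_ isT isT); rewrite /th; lra.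
have cs := cos2Dsin2 th.
have th3 : th + th + th = pi *+ 2 by rewrite /th; lra.
have := cos2pi R; rewrite -th3 2!cosD sinD.
have := sin2pi R; rewrite -th3 2!sinD cosD.
move: c1 cs rot; set c := cos th; set n := sin th => c1 cs rot s3 c3.
split.
  apply/subr0_eq/(face_span k20) => x Fx; rewrite mulmxBl mul1mx -!mulmxA.
  have [s [t xE]] := span _ Fx; rewrite xE in Fx *.
  have F1 := stab _ Fx; rewrite (rot _ _ Fx) in F1 *.
  have F2 := stab _ F1; rewrite (rot _ _ F1) in F2 *.
  rewrite (rot _ _ F2); apply/eqP; rewrite subr_eq0; apply/eqP.
  (* c3 and s3 say that 1 and 0 are the cosine and the sine of 3 th *)
  congr (_ + _ *: _ + _ *: _).
    rewrite -[RHS]mul1r -c3 -[RHS]subr0 -(mul0r t) -s3; ring.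
  rewrite -[RHS]mul1r -c3 -[RHS]addr0 -(mul0r s) -s3; ring.
apply/negP => /eqP a1; apply: (@face_not_line k ctr 0 k20) => x Fx; exists 0.
rewrite scaler0 addr0; have [s [t xE]] := span _ Fx; rewrite xE in Fx *.
have := rot _ _ Fx; rewrite a1 mul1mx => /(frame_inj fr)[es et].
(* the determinant of the linear system that a fixed point satisfies *)
have d0 : (1 - c) ^+ 2 + n ^+ 2 != 0.
  have -> : (1 - c) ^+ 2 + n ^+ 2 = 2 * (1 - c) + (c ^+ 2 + n ^+ 2 - 1) by ring.
  by rewrite cs subrr addr0 mulf_neq0 ?pnatr_eq0// subr_eq0 eq_sym.
have e1 : (1 - c) * s = - (n * t) by lra.
have e2 : (1 - c) * t = n * s by lra.
have -> : s = 0.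
  apply: (mulfI d0); rewrite mulr0.
  transitivity ((1 - c) * ((1 - c) * s) + n * (n * s)); first by ring.
  by rewrite e1 -e2; ring.
have -> : t = 0.
  apply: (mulfI d0); rewrite mulr0.
  transitivity ((1 - c) * ((1 - c) * t) + n * (n * t)); first by ring.
  by rewrite e2 -[n * t]opprK -e1; ring.
by rewrite !scale0r !addr0.
Qed.

(** Were the map the identity, the face would lie on the axis of reflection. *)
Lemma reflection_square k (a : 'M[R]_3) : (k < 20)%N ->
  mulmx a @` face_set k = face_set k ->
  is_reflection (face_set k) (mulmx a) -> a *m a = 1%:M /\ a != 1%:M.
Proof.
move=> k20 aF [ctr [u [v [fr refl]]]].
have [_ _ _ span] := fr.
have stab x : face_set k x -> face_set k (a *m x) by rewrite -{2}aF; exists x.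
split.
  apply/subr0_eq/(face_span k20) => x Fx; rewrite mulmxBl mul1mx -!mulmxA.
  have [s [t xE]] := span _ Fx; rewrite xE in Fx *.
  have F1 := stab _ Fx; rewrite (refl _ _ Fx) -scaleNr in F1 *.
  by rewrite (refl _ _ F1) scaleNr opprK subrr.
apply/negP => /eqP a1; apply: (@face_not_line k ctr u k20) => x Fx.
have [s [t xE]] := span _ Fx; exists s; rewrite xE in Fx *.
have := refl _ _ Fx; rewrite a1 mul1mx -scaleNr => /(frame_inj fr)[_ et].
have -> : t = 0 by lra.
by rewrite scale0r addr0.
Qed.

End FaceIsometries.

(** * Counting equivariant sections *)

(** A map [sigma] on I is covered by maps [theta i : T -> T] from the fibre over i
to the fibre over [sigma i].  Each point i lies [pos i] steps after the base
[root i] of its cycle, and [len i] steps bring i back to itself. *)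
Section EquivariantSections.
Variables (I T : finType) (sigma root : I -> I) (pos len : I -> nat) (theta : I -> T -> T).

Fixpoint transport i n t :=
  if n is m.+1 then theta (iter m sigma i) (transport i m t) else t.

Hypothesis rootE : forall i, root (sigma i) = root i.
Hypothesis posE : forall i, iter (pos i) sigma (root i) = i.
Hypothesis pos_root : forall i, root i = i -> pos i = 0%N.
Hypothesis lenE : forall i, iter (len i) sigma i = i.
Hypothesis step : forall i,
  (sigma i = root i /\ (pos i).+1 = len (sigma i)) \/ pos (sigma i) = (pos i).+1.

Definition equivariant : {set {ffun I -> T}} :=
  [set x : {ffun I -> T} | [forall i, x (sigma i) == theta i (x i)]]%SET.

Definition holonomy_fixed i : {set T} := [set t | transport i (len i) t == t]%SET.

Let iter_equivariant x : x \in equivariant ->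
  forall i n, x (iter n sigma i) = transport i n (x i).
Proof.
rewrite inE => /forallP xe i; elim=> //= n IHn.
by rewrite (eqP (xe _)) IHn.
Qed.

Let root_root i : root (root i) = root i.
Proof.
have h n : root (iter n sigma (root i)) = root (root i).
  by elim: n => //= n <-; rewrite rootE.
by rewrite -[in RHS](posE i) h.
Qed.

(** Restriction to the bases of the cycles is a bijection from the equivariant
sections to the families of holonomy-fixed elements over the bases: transport
along the cycles is its inverse, and the fixed-point condition makes it
consistent where a cycle closes up. *)
Lemma card_equivariant :
  #|equivariant| = (\prod_(i | root i == i) #|holonomy_fixed i|)%N.
Proof.
pose reps := [pred i | root i == i]; pose J := {i | i \in reps}.
pose restrict (x : {ffun I -> T}) : {ffun J -> T} := [ffun j => x (val j)].
have restr_inj : {in equivariant &, injective restrict}.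
  move=> x y xe ye xy; apply/ffunP => i.
  rewrite -(posE i) !iter_equivariant//; congr transport.
  have rr : root (root i) == root i by rewrite root_root.
  by have /ffunP/(_ (exist _ (root i) rr : J)) := xy; rewrite !ffunE.
rewrite -(card_in_imset restr_inj).
transitivity #|family (fun j : J => mem (holonomy_fixed (val j)))|; last first.
  rewrite card_family foldrE big_image /=.
  by rewrite -(big_sub reps (fun i => #|holonomy_fixed i|)).
apply: eq_card => y; apply/imsetP/familyP => [[x xe ->] j|yh].
  by rewrite ffunE inE -iter_equivariant// lenE.
have rr i : root (root i) == root i by rewrite root_root.
pose x : {ffun I -> T} := [ffun i => transport (root i) (pos i) (y (exist _ (root i) (rr i) : J))].
have xE i j : root i = val j -> x i = transport (val j) (pos i) (y j).
  move=> ij; have -> : j = exist _ (root i) (rr i) by apply: val_inj.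
  by rewrite ffunE.
exists x; last first.
  apply/ffunP => j; rewrite ffunE (xE _ j) ?(eqP (valP j))//.
  by rewrite pos_root// (eqP (valP j)).
rewrite inE; apply/forallP => i; apply/eqP.
pose j : J := exist _ (root i) (rr i).
rewrite (xE i j)// (xE (sigma i) j) ?rootE//.
case: (step i) => [[si pi]|->]; last by rewrite /= posE.
have -> : pos (sigma i) = 0%N by rewrite pos_root// rootE si.
by have := yh j; rewrite inE /= -si -pi /= si posE => /eqP /= ->.
Qed.

End EquivariantSections.

(** * The symmetry group as a group of permutations of the faces *)

Section FacePermutations.
Local Open Scope nat_scope.
Implicit Types s t : {perm 'I_20}.

Definition code s : seq nat := [seq val (s i) | i <- enum 'I_20].

Lemma nth_code s (i : 'I_20) : nth 0 (code s) i = s i.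
Proof. by rewrite (nth_map i) ?size_enum_ord// nth_ord_enum. Qed.

Lemma code_inj : injective code.
Proof. by move=> s t st; apply/permP => i; apply: val_inj; rewrite /= -!nth_code st. Qed.

Lemma size_code s : size (code s) = 20.
Proof. by rewrite size_map size_enum_ord. Qed.

Lemma eq_code s c : size c = 20 -> (forall i : 'I_20, nth 0 c i = s i) -> code s = c.
Proof.
move=> sc h; apply: (@eq_from_nth _ 0); rewrite size_code// => i i20.
by rewrite (nth_code s (Ordinal i20)) -h.
Qed.

Lemma code_valid s : valid (code s).
Proof.
apply: uniq_perm; rewrite ?iota_uniq//.
  by rewrite map_inj_uniq ?enum_uniq// => i j /val_inj /perm_inj.
move=> k; rewrite mem_iota /=; apply/mapP/idP => [[i _ ->]|k20]; first exact: ltn_ord.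
by exists ((s^-1)%g (Ordinal k20)); rewrite ?mem_enum ?permKV.
Qed.

Lemma code1 : code 1%g = code_id.
Proof. by apply: eq_code => // i; rewrite nth_iota// perm1. Qed.

(** Products of permutations are read from left to right, products of codes from
right to left. *)
Lemma codeM s t : code (s * t)%g = code_comp (code t) (code s).
Proof.
apply: eq_code; first by rewrite size_map size_code.
by move=> i; rewrite nth_code_comp ?code_valid// !nth_code permM.
Qed.

Lemma codeX s n : code (s ^+ n)%g = code_pow (code s) n.
Proof.
elim: n => [|n IHn]; first by rewrite expg0 code1.
by rewrite expgSr codeM IHn.
Qed.

Lemma iter_code s n (i : 'I_20) : iter n (nth 0 (code s)) i = iter n s i.
Proof. by elim: n => //= n ->; rewrite nth_code. Qed.

Lemma code_surj c : valid c -> exists s, code s = c.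
Proof.
move=> vc; pose f (i : 'I_20) : 'I_20 := Ordinal (ltn_valid vc (ltn_ord i)).
have f_inj : injective f.
  move=> i j [] /eqP; rewrite nth_uniq ?size_valid// => [/eqP/val_inj//|].
  by rewrite (perm_uniq vc) iota_uniq.
exists (perm f_inj); apply: eq_code => [|i]; first exact: size_valid.
by rewrite permE.
Qed.

Definition symmetries : {set {perm 'I_20}} := [set s | code s \in codes]%SET.

Lemma symmetries_group_set : group_set symmetries.
Proof.
apply/group_setP; split; first by rewrite finset.in_set code1 codes_id.
by move=> s t; rewrite !finset.in_set codeM => sL tL; exact: codes_comp.
Qed.
Canonical symmetries_group := group symmetries_group_set.

(** Hence sums over the group become sums over the explicit list. *)
Lemma codes_perm : perm_eq [seq code s | s <- enum symmetries] codes.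
Proof.
apply: uniq_perm; rewrite ?codes_uniq ?(map_inj_uniq code_inj) ?enum_uniq// => c.
apply/mapP/idP => [[s]|cL]; first by rewrite mem_enum finset.in_set => sL ->.
have [s sc] := code_surj (codes_valid cL).
by exists s; rewrite ?mem_enum ?finset.in_set sc.
Qed.

Lemma sum_symmetries (f : seq nat -> nat) :
  \sum_(s in symmetries) f (code s) = \sum_(c <- codes) f c.
Proof. by rewrite -(perm_big _ codes_perm) big_map big_enum. Qed.

Lemma card_symmetries : #|symmetries| = 120.
Proof. by rewrite cardE -(size_map code) (perm_size codes_perm). Qed.

Lemma code_order_index s : exists l : seq {perm 'I_20},
  code_order (code s) = (index 1%g [:: s, s * s, s * s * s & l]%g).+1.
Proof.
exists [seq (s ^+ n.+1)%g | n <- iota 3 7].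
rewrite /code_order -code1 -(index_map code_inj); congr (index _ _).+1.
rewrite -[iota 0 10]/[:: 0, 1, 2 & iota 3 7] !map_cons -!codeX !expgSr expg0 mul1g.
by do 3!congr (_ :: _); rewrite -map_comp; apply: eq_map => n; rewrite /= codeX.
Qed.

Lemma code_order1 s : code_order (code s) = 1 -> s = 1%g.
Proof. by have [l ->] := code_order_index s; rewrite /=; have [|] := eqVneq s 1%g. Qed.

Lemma code_order2 s : s != 1%g -> (s * s)%g = 1%g -> code_order (code s) = 2.
Proof. by have [l ->] := code_order_index s; move=> /= /negPf -> ->; rewrite eqxx. Qed.

Lemma code_order3 s : s != 1%g -> (s * s * s)%g = 1%g -> code_order (code s) = 3.
Proof.
have [l ->] := code_order_index s; move=> s1 s3 /=.
have /negPf -> : (s * s)%g != 1%g by apply: contra s1 => /eqP e; rewrite -s3 e mul1g.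
by rewrite (negPf s1) s3 eqxx.
Qed.

End FacePermutations.

(** * Matrices of the symmetries *)

Section SymmetryMatrices.
Variable R : realType.
Local Notation Ih := (Ih R).

Definition symmetry_mx (s : {perm 'I_20}) : 'M[R]_3 :=
  xget 0 [set a | Ih a /\ realises a (code s)].
Local Notation M := symmetry_mx.

Lemma symmetry_mxP s : s \in symmetries -> Ih (M s) /\ realises (M s) (code s).
Proof.
rewrite finset.in_set => /(codes_realised R)[a Ia ac].
exact: (xgetI 0 (conj Ia ac : [set a | Ih a /\ realises a (code s)] a)).
Qed.

Lemma symmetry_mx_eq s a : s \in symmetries -> realises a (code s) -> M s = a.
Proof. by move=> /symmetry_mxP[_ Ms] ac; exact: realises_inj Ms ac. Qed.

Lemma symmetry_mx1 : M 1%g = 1%:M.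
Proof. by apply: symmetry_mx_eq; [exact: group1 | rewrite code1; exact: realises1]. Qed.

Lemma symmetry_mxM s t : s \in symmetries -> t \in symmetries -> M (s * t)%g = M t *m M s.
Proof.
move=> sH tH; apply: symmetry_mx_eq; first exact: groupM.
rewrite codeM; apply: realisesM; first exact: code_valid.
  by case: (symmetry_mxP tH). by case: (symmetry_mxP sH).
Qed.

Lemma symmetry_mx_surj a : Ih a -> exists2 s, s \in symmetries & M s = a.
Proof.
move=> /Ih_code[c cL ac]; have [s sc] := code_surj (codes_valid cL).
have sH : s \in symmetries by rewrite finset.in_set sc.
by exists s => //; apply: symmetry_mx_eq; rewrite ?sc.
Qed.

Lemma normal_inj j k : (j < 20)%N -> (k < 20)%N -> normal R j = normal R k -> j = k.
Proof. by move=> j20 k20 jk; apply: (@face_set_inj R) => //; rewrite /face_set jk. Qed.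

Lemma symmetry_mx_inj : {in symmetries &, injective M}.
Proof.
move=> s t /symmetry_mxP[_ Ms] /symmetry_mxP[_ Mt] st; apply/permP => i.
apply: val_inj; apply: normal_inj; rewrite /= ?ltn_ord//.
by rewrite -!nth_code -Ms// -Mt// st.
Qed.

Lemma symmetry_mx_eq1 s : s \in symmetries -> M s = 1%:M -> s = 1%g.
Proof.
by move=> sH; rewrite -symmetry_mx1 => /(symmetry_mx_inj sH (group1 symmetries_group)).
Qed.

Definition face (k : 'I_20) : faces (icosahedron R) :=
  exist _ (face_set k) (mem_set (is_face_face_set R (ltn_ord k))).

Lemma face_inj : injective face.
Proof.
by move=> j k /(congr1 val) /= /face_set_inj jk; apply: val_inj; apply: jk.
Qed.

Lemma face_surj (F : faces (icosahedron R)) : exists k, F = face k.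
Proof.
have [k k20 Fk] := face_classification (set_mem (valP F)).
by exists (Ordinal k20); apply: val_inj.
Qed.

Lemma symmetry_face s k : s \in symmetries -> mulmx (M s) @` val (face k) = val (face (s k)).
Proof.
move=> /symmetry_mxP[Is Ms]; rewrite /= (Ih_face_set Is Ms)//.
by rewrite nth_code.
Qed.

End SymmetryMatrices.

(** * The action on tilings *)

Lemma card_set_of_finset (X : finType) (A : {set X}) : ([set` A] #= `I_#|A|)%card.
Proof.
have [->|[x0 x0A]] := set_0Vmem A.
  by rewrite cards0 II0; have -> : [set` finset.set0] = set0 :> set X
    by apply/seteqP; split=> x //=; rewrite finset.in_set0.
have -> : [set` A] = nth x0 (enum A) @` `I_#|A|.
  apply/seteqP; split=> [x /= xA|_ [n /= nA <-]] /=.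
    by exists (index x (enum A)); rewrite /= ?nth_index ?mem_enum// cardE index_mem mem_enum.
  by rewrite -mem_enum mem_nth// -cardE.
apply: inj_card_eq => i j; rewrite !inE /= cardE => iA jA /eqP.
by rewrite nth_uniq ?enum_uniq// => /eqP.
Qed.

Section Tilings.
Variables (R : realType) (T : finType) (D : tile_designs (Ih R) (icosahedron R) T).
Local Notation M := (symmetry_mx R).
Local Notation face := (face R).
Local Notation H := symmetries.

Definition move_tile s k (t : T) : T := (D (M s) (t, face k)).1.

Lemma move_tileE s k t : s \in H -> D (M s) (t, face k) = (move_tile s k t, face (s k)).
Proof.
move=> sH; rewrite [LHS]surjective_pairing; congr pair; apply: val_inj.
by rewrite td_over ?symmetry_face//; case: (symmetry_mxP R sH).
Qed.

Lemma move_tile1 k t : move_tile 1%g k t = t.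
Proof. by rewrite /move_tile symmetry_mx1 td_act1. Qed.

Lemma move_tileM s u k t : s \in H -> u \in H ->
  move_tile (s * u)%g k t = move_tile u (s k) (move_tile s k t).
Proof.
move=> sH uH; rewrite {1}/move_tile symmetry_mxM// td_actM.
- by rewrite move_tileE// move_tileE.
- by case: (symmetry_mxP R uH).
- by case: (symmetry_mxP R sH).
Qed.

Lemma move_tileK s k : s \in H -> cancel (move_tile s k) (move_tile s^-1%g (s k)).
Proof. by move=> sH t; rewrite -move_tileM ?groupV// mulgV move_tile1. Qed.

Lemma move_tile_inj s k : s \in H -> injective (move_tile s k).
Proof. by move=> sH; exact: can_inj (move_tileK k sH). Qed.

(** Actions are total functions, so the permutations outside the group are made
to act trivially. *)
Definition move_tiling (x : {ffun 'I_20 -> T}) s : {ffun 'I_20 -> T} :=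
  if s \in H then [ffun k => move_tile s (s^-1%g k) (x (s^-1%g k))] else x.

Lemma move_tilingE x s k : s \in H -> move_tiling x s (s k) = move_tile s k (x k).
Proof. by move=> sH; rewrite /move_tiling sH ffunE permK. Qed.

Lemma move_tiling_is_action : is_action H move_tiling.
Proof.
split=> [s x y xy|x s u sH uH].
  have [sH|sH] := boolP (s \in H); last by move: xy; rewrite /move_tiling (negPf sH).
  apply/ffunP => k; apply: (@move_tile_inj s k sH).
  by rewrite -!move_tilingE// xy.
apply/ffunP => k; rewrite -[k](permKV (s * u)%g) move_tilingE ?groupM//.
by rewrite permM !move_tilingE// move_tileM.
Qed.

Canonical tiling_action := Action move_tiling_is_action.

Definition face_index (F : faces (icosahedron R)) : 'I_20 := xget ord0 [set k | F = face k].

Lemma face_indexK F : face (face_index F) = F.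
Proof.
by have [k Fk] := face_surj F; symmetry; exact: (xgetI ord0 (Fk : [set k | F = face k] k)).
Qed.

Lemma faceK k : face_index (face k) = k.
Proof. by apply: (@face_inj R); rewrite face_indexK. Qed.

Local Notation tiling := (tiling (icosahedron R) T).
Definition labelling (tau : tiling) : {ffun 'I_20 -> T} := [ffun k => tau (face k)].
Definition tiling_of (x : {ffun 'I_20 -> T}) : tiling := fun F => x (face_index F).

Lemma tiling_ofK : cancel tiling_of labelling.
Proof. by move=> x; apply/ffunP => k; rewrite ffunE /tiling_of faceK. Qed.

(** Tilings correspond to labellings of the 20 faces, and under this
correspondence the relation [moves] is the graph of the action. *)
Lemma movesP s tau tau' : s \in H ->
  moves D (M s) tau tau' <-> labelling tau' = move_tiling (labelling tau) s.
Proof.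
move=> sH; split=> [mv|e].
  apply/ffunP => k; rewrite -[k](permKV s) move_tilingE// !ffunE.
  set j := (s^-1)%g k; have := mv (face j) (face (s j)).
  by rewrite symmetry_face// move_tileE// => /(_ erefl)[].
move=> F F'; rewrite -(face_indexK F) -(face_indexK F') symmetry_face// => /val_inj ->.
rewrite move_tileE//; congr pair.
have /ffunP/(_ (s (face_index F))) := e.
by rewrite move_tilingE// !ffunE.
Qed.

(** Each matrix of the group comes from a permutation in [symmetries], so the
orbits of the two groups are the same. *)
Lemma tiling_orbitE tau :
  tiling_orbit D tau = [set tau' | labelling tau' \in orbit tiling_action H (labelling tau)].
Proof.
apply/seteqP; split=> tau' /=.
  move=> [a /(symmetry_mx_surj)[s sH <-]] /(movesP _ _ sH) ->.
  exact: (mem_orbit tiling_action).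
by move=> /orbitP[s sH /esym/(movesP _ _ sH) mv]; exists (M s) => //; case: (symmetry_mxP R sH).
Qed.

Definition labelling_orbits : {set {set {ffun 'I_20 -> T}}} :=
  [set orbit tiling_action H x | x in [set: {ffun 'I_20 -> T}]]%SET.

Lemma card_tiling_orbits : (tiling_orbits D #= `I_#|labelling_orbits|)%card.
Proof.
pose f (w : {set {ffun 'I_20 -> T}}) := [set tau | labelling tau \in w].
have f_inj : injective f.
  move=> w w' /seteqP[ww' w'w]; apply/setP => x; rewrite -(tiling_ofK x).
  by apply/idP/idP => [/ww'|/w'w].
have -> : tiling_orbits D = f @` [set` labelling_orbits].
  apply/seteqP; split=> [_ [tau _ <-]|_ [w /= /imsetP[x _ ->] <-]] /=.
    exists (orbit tiling_action H (labelling tau)); rewrite ?tiling_orbitE//.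
    by apply/imsetP; exists (labelling tau).
  by exists (tiling_of x) => //; rewrite tiling_orbitE tiling_ofK.
apply: card_eq_trans (card_set_of_finset _); apply: inj_card_eq => w w' _ _; exact: f_inj.
Qed.

End Tilings.

(** * The orbit count *)

Section Burnside.
Variables (R : realType) (T : finType) (D : tile_designs (Ih R) (icosahedron R) T).
Local Notation M := (symmetry_mx R).
Local Notation face := (face R).
Local Notation H := symmetries.
Local Notation move_tile := (move_tile D).
Local Notation to := (tiling_action D).

Definition fixed_set s k : {set T} := [set t | move_tile s k t == t]%SET.

Lemma fixed_tilesE s k : s \in H -> s k = k -> fixed_tiles D (M s) (face k) = #|fixed_set s k|.
Proof.
move=> sH sk; rewrite /fixed_tiles; apply: eq_card => t.
by rewrite !inE move_tileE// sk xpair_eqE eqxx andbT.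
Qed.

(** Moving by d intertwines s on the face j with its conjugate u on the face
d j. *)
Lemma card_fixed_conj s u d j : s \in H -> u \in H -> d \in H -> s j = j ->
  (s * d = d * u)%g -> #|fixed_set s j| = #|fixed_set u (d j)|.
Proof.
move=> sH uH dH sj sd.
have dinj := @move_tile_inj R T D d j dH.
rewrite -[RHS](card_preimset _ dinj); apply: eq_card => t.
by rewrite !inE -move_tileM// -sd move_tileM// sj (inj_eq dinj).
Qed.

Lemma stabilizer_stab_pairs s k : s \in H -> s k = k ->
  (code s, val k) \in stab_pairs (code_order (code s)).
Proof.
rewrite finset.in_set => sL sk.
by apply/(introT idP); rewrite mem_stab_pairs nth_code sk sL ltn_ord !eqxx.
Qed.

Lemma card_fixed_conjugate s u (j k : 'I_20) : s \in H -> u \in H -> s j = j ->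
  conjugate (code s, val j) (code u, val k) -> #|fixed_set s j| = #|fixed_set u k|.
Proof.
move=> sH uH sj /hasP[_ /[dup] /codes_valid/code_surj[d <-] dL] /= /andP[].
rewrite nth_code -!codeM => /eqP dj /eqP/code_inj sd.
have dH : d \in H by rewrite finset.in_set.
by rewrite (card_fixed_conj sH uH dH sj sd); congr #|fixed_set u _|; apply: val_inj.
Qed.

(** Both pairs (element, fixed face) are conjugate to one common pair. *)
Lemma card_fixed_order s u j k : s \in H -> u \in H -> s j = j -> u k = k ->
  code_order (code s) = code_order (code u) -> code_order (code u) \in [:: 2; 3]%N ->
  #|fixed_set s j| = #|fixed_set u k|.
Proof.
move=> sH uH sj uk su /stab_pairs_conjugate[[c i] oL oP].
have := oP _ (stabilizer_stab_pairs uH uk); have := stabilizer_stab_pairs sH sj; rewrite su => /oP.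
move: oL; rewrite mem_stab_pairs => /and4P[/eqP ci cL _ i20].
have [p pc] := code_surj (codes_valid cL); rewrite -pc in cL ci *.
have pH : p \in H by rewrite finset.in_set.
have pi : p (Ordinal i20) = Ordinal i20 by apply: val_inj; rewrite /= -nth_code.
rewrite -[i]/(val (Ordinal i20)) => cs cu.
by rewrite -(card_fixed_conjugate pH sH pi cs) (card_fixed_conjugate pH uH pi cu).
Qed.

Definition cycle_base s (i : 'I_20) : 'I_20 := inord (cycle_root (code s) i).

(** The fixed tilings are the sections that are equivariant under s, and the
holonomy of a cycle is the power of s by the length of the cycle. *)
Lemma card_fix s : s \in H ->
  #|'Fix_([set: {ffun 'I_20 -> T}]%SET | to)[s]%g| =
  (\prod_(i | cycle_base s i == i) #|fixed_set (s ^+ cycle_len (code s) i)%g i|)%N.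
Proof.
move=> sH; have sL : code s \in codes by move: sH; rewrite finset.in_set.
have rootE i : cycle_base s i = cycle_root (code s) i :> nat.
  by rewrite inordK// cycle_root_lt.
have cyc i := cycles_correct sL (ltn_ord i).
transitivity #|equivariant s (move_tile s)|.
  apply: eq_card => x; rewrite finset.in_setI finset.in_setT /=.
  apply/afix1P/idP => [xs|].
    rewrite inE; apply/forallP => i; rewrite -move_tilingE//.
    by rewrite (_ : move_tiling D x s = x)//; exact: xs.
  rewrite inE => /forallP xs; apply/ffunP => i; rewrite -[i](permKV s).
  by rewrite -[LHS]/(move_tiling D x s _) move_tilingE// -(eqP (xs _)).
have mX n k t : transport s (move_tile s) k n t = move_tile (s ^+ n)%g k t.
  elim: n => [|n IHn] /=; first by rewrite expg0 move_tile1.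
  by rewrite IHn expgSr move_tileM ?groupX// permX.
rewrite (@card_equivariant _ _ s (cycle_base s) (fun i => cycle_pos (code s) i)
   (fun i => cycle_len (code s) i)).
- apply: eq_bigr => i _; apply: eq_card => t; by rewrite !inE mX.
- move=> i; have [h _ _ _ _] := cyc i; apply: ord_inj; rewrite !rootE -nth_code; exact: h.
- move=> i; have [_ h _ _ _] := cyc i; apply: ord_inj; rewrite -iter_code rootE; exact: h.
- move=> i /(congr1 (@nat_of_ord 20)); have [_ _ h _ _] := cyc i; rewrite rootE; exact: h.
- move=> i; have [_ _ _ h _] := cyc i; apply: ord_inj; rewrite -iter_code; exact: h.
- move=> i; rewrite -nth_code; have [_ _ _ _ [[e1 e2]|e]] := cyc i; [left|by right].
  by split=> //; apply: ord_inj; rewrite -nth_code e1 rootE.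
Qed.

(** The Cauchy-Frobenius formula; [w n] is the number of tiles that a holonomy of
order n fixes. *)
Lemma card_orbits_sum (w : nat -> nat) :
  (forall s k, s \in H -> s k = k -> code_order (code s) \in [:: 1; 2; 3]%N ->
     #|fixed_set s k| = w (code_order (code s))) ->
  (#|labelling_orbits D| * 120 =
   \sum_(c <- codes) \prod_(n <- holonomy_orders c) w n)%N.
Proof.
move=> hw; rewrite -card_symmetries.
have toP : [acts symmetries_group, on [set: {ffun 'I_20 -> T}]%SET | to].
  apply/fintype.subsetP => s sH; rewrite finset.in_setI sH finset.in_set /=.
  by apply/fintype.subsetP => x _; rewrite finset.in_set finset.in_setT.
rewrite -(Frobenius_Cauchy toP) -sum_symmetries; apply: eq_bigr => s sH.
have sL : code s \in codes by move: sH; rewrite finset.in_set.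
rewrite card_fix// /holonomy_orders big_map big_filter.
rewrite -[code_id]/(index_iota 0 20) big_mkord; apply: eq_big => i.
  by rewrite -val_eqE /= inordK// cycle_root_lt.
move=> /eqP ri; have [_ _ _ li _] := cycles_correct sL (ltn_ord i).
rewrite -codeX; apply: hw; first exact: groupX.
  by apply: ord_inj; rewrite permX -iter_code.
rewrite codeX; apply: holonomy_order_cases => //.
by rewrite -[in RHS]ri inordK// cycle_root_lt.
Qed.

End Burnside.

Theorem theorem13 (R : realType) (T : finType)
    (D : tile_designs (Ih R) (icosahedron R) T)
    (F : faces (icosahedron R)) (r f : 'M[R]_3)
    (r_stab : face_stabilizer (Ih R) F r)
    (r_rot : is_rotation (2 * pi / 3) (val F) (mulmx r))
    (f_stab : face_stabilizer (Ih R) F f)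
    (f_refl : is_reflection (val F) (mulmx f))
    (t_id t_r t_f : nat)
    (t_idE : t_id = #|T|)
    (t_rE : t_r = fixed_tiles D r F)
    (t_fE : t_f = fixed_tiles D f F) :
  exists n : nat,
    (tiling_orbits D #= `I_n)%card /\
    n%:R = 1 / 120 *
      (t_id%:R ^+ 20 + 24 * t_id%:R ^+ 4 + 20 * t_id%:R ^+ 6 * t_r%:R ^+ 2
       + 15 * t_id%:R ^+ 10 + t_id%:R ^+ 10 + 24 * t_id%:R ^+ 2
       + 20 * t_id%:R ^+ 3 * t_r%:R + 15 * t_id%:R ^+ 8 * t_f%:R ^+ 4) :> rat.
Proof.
have [k Fk] := face_surj F.
have [Ir rF] := r_stab; have [If fF] := f_stab.
have [sr srH rE] := symmetry_mx_surj Ir; have [sf sfH fE] := symmetry_mx_surj If.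
have stabk s : s \in symmetries -> mulmx (symmetry_mx R s) @` val F = val F -> s k = k.
  by move=> sH; rewrite Fk symmetry_face// => /val_inj/face_inj.
have srk : sr k = k by apply: stabk; rewrite ?rE.
have sfk : sf k = k by apply: stabk; rewrite ?fE.
(* r and f have the orders that select w 3 = t_r and w 2 = t_f *)
have sr3 : code_order (code sr) = 3%N.
  have [||r3 r1] := @rotation_cube R k r (ltn_ord k);
    [by rewrite Fk in rF|by rewrite Fk in r_rot|].
  apply: code_order3; first by apply: contra r1 => /eqP s1; rewrite -rE s1 symmetry_mx1.
  have sr2H : (sr * sr)%g \in symmetries by exact: groupM.
  apply: (@symmetry_mx_eq1 R); first exact: groupM.
  by rewrite (symmetry_mxM _ sr2H srH) (symmetry_mxM _ srH srH) rE mulmxA.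
have sf2 : code_order (code sf) = 2%N.
  have [||f2 f1] := @reflection_square R k f (ltn_ord k);
    [by rewrite Fk in fF|by rewrite Fk in f_refl|].
  apply: code_order2; first by apply: contra f1 => /eqP s1; rewrite -fE s1 symmetry_mx1.
  apply: (@symmetry_mx_eq1 R); first exact: groupM.
  by rewrite (symmetry_mxM _ sfH sfH) fE.
exists #|labelling_orbits D|; split; first exact: card_tiling_orbits.
pose w n := if n == 1%N then t_id else if n == 2%N then t_f else t_r.
have := @card_orbits_sum R T D w; rewrite sum_codes /w /=.
have hw s j : s \in symmetries -> s j = j -> code_order (code s) \in [:: 1; 2; 3]%N ->
     #|fixed_set D s j| = w (code_order (code s)).
  move=> sH sj; rewrite !inE => /or3P[] /eqP o; rewrite o /w /=.
  - rewrite (code_order1 o) t_idE; apply: eq_card => t; by rewrite inE move_tile1 eqxx.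
  - rewrite t_fE -fE Fk fixed_tilesE//; by apply: card_fixed_order; rewrite ?sf2.
  - rewrite t_rE -rE Fk fixed_tilesE//; by apply: card_fixed_order; rewrite ?sr3.
move=> /(_ hw) /(congr1 (fun n => n%:R : rat)).
move=> /= e; apply: (@mulIf _ 120); first by [].
by rewrite -[X in _ * X = _]/(120%:R) -natrM e; field.
Qed.
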